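(* For any $m\ge1$ and any constant $\lambda\in(0,1)$, \textsf{MaxT} admits a polynomial-time $\Omega(1)$-approximation algorithm (with the constant depending only on $\lambda$) on every laminar instance with $m$ hosts satisfying $p_j\le\lambda|\chi_j|$ for all jobs $j$.
   Context: \textsf{MaxT} (preemptive throughput maximization): time is slotted into integer slots. There is a set $M$ of $m$ identical hosts, each having one unit of a single resource, and a set $J$ of jobs. Each job $j$ has a time window $\chi_j=[r_j,d_j]$ (integer slots, $|\chi_j|=d_j-r_j+1$), processing length $p_j\in\mathbb{Z}_{>0}$, resource requirement $s_j\in(0,1]$ and profit $w_j\ge0$. A subset $S\subseteq J$ is feasibly scheduled if there are sets $S_{i,t}\subseteq S$ (jobs run on host $i$ at slot $t$) such that: $j\in S_{i,t}$ only if $t\in\chi_j$; $\sum_{j\in S_{i,t}}s_j\le1$ for all $i,t$; no job runs on two different hosts in the same slot; and each $j\in S$ runs in at least $p_j$ distinct slots of $\chi_j$ (preemption and migration allowed). The goal is to maximize $\sum_{j\in S}w_j$ over feasibly scheduled $S$. The instance is laminar if $\{\chi_j:j\in J\}$ is a laminar family (any two intervals nested or disjoint). *)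

(* Defs.v *)
From mathcomp Require Import all_boot all_order all_algebra.
From mathcomp Require Import reals.
Set Implicit Arguments.
Unset Strict Implicit.
Unset Printing Implicit Defensive.
Import Order.TTheory GRing.Theory Num.Theory.
Local Open Scope ring_scope.

(** * Model of computation

   A deterministic first-order functional language with recursion over binary
   trees whose leaves are arbitrary-precision integers, under the logarithmic
   cost criterion: every evaluation step is charged the bit size of the value
   it produces.  No step is cheaper than the length of what it writes, and each
   primitive is computable in time polynomial in the length of its operands, so
   running time here agrees with Turing-machine running time up to a
   polynomial. *)

Inductive value := VInt of int | VPair of value & value.

(* For an integer: its bit length, plus one for the sign. *)
Fixpoint vsize (v : value) : nat :=
  match v with
  | VInt z => (trunc_log 2 `|z|%N).+2
  | VPair v1 v2 => (vsize v1 + vsize v2).+1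
  end.

(* The integer 0 plays the roles of "false" and of the empty list. *)
Definition truthy (v : value) : bool := if v is VInt z then z != 0 else true.

Inductive prim := Add | Sub | Mul | Div | Leq.

Definition apply_prim (o : prim) (x y : int) : int :=
  match o with
  | Add => x + y
  | Sub => x - y
  | Mul => x * y
  | Div => (x %/ y)%Z
  | Leq => if x <= y then 1 else 0
  end.

(* Variables are de Bruijn indices; [ELet] binds index 0 in its body. *)
Inductive expr :=
| EVar of nat
| EInt of int
| EPrim of prim & expr & expr
| EPair of expr & expr
| EFst of expr
| ESnd of expr
| EIf of expr & expr & expr
| ELet of expr & expr
| ECall of nat & expr.

(* A table of mutually recursive unary functions, the entry point being
   function 0; in a function body, index 0 is the argument. *)
Definition program := seq expr.

(* [eval p env e v t]: under [env], [e] terminates with value [v] at cost [t].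
   Ill-typed operations have no derivation. *)
Inductive eval (p : program) : seq value -> expr -> value -> nat -> Prop :=
| EvalVar env i v :
    onth env i = Some v -> eval p env (EVar i) v (vsize v)
| EvalInt env z :
    eval p env (EInt z) (VInt z) (vsize (VInt z))
| EvalPrim env o e1 e2 x y t1 t2 :
    eval p env e1 (VInt x) t1 -> eval p env e2 (VInt y) t2 ->
    eval p env (EPrim o e1 e2) (VInt (apply_prim o x y))
      (t1 + t2 + vsize (VInt (apply_prim o x y)))
| EvalPair env e1 e2 v1 v2 t1 t2 :
    eval p env e1 v1 t1 -> eval p env e2 v2 t2 ->
    eval p env (EPair e1 e2) (VPair v1 v2) (t1 + t2 + vsize (VPair v1 v2))
| EvalFst env e v1 v2 t :
    eval p env e (VPair v1 v2) t -> eval p env (EFst e) v1 (t + vsize v1)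
| EvalSnd env e v1 v2 t :
    eval p env e (VPair v1 v2) t -> eval p env (ESnd e) v2 (t + vsize v2)
| EvalIf env e e1 e2 b v tb t :
    eval p env e b tb -> eval p env (if truthy b then e1 else e2) v t ->
    eval p env (EIf e e1 e2) v (tb + t + vsize v)
| EvalLet env e1 e2 v1 v2 t1 t2 :
    eval p env e1 v1 t1 -> eval p (v1 :: env) e2 v2 t2 ->
    eval p env (ELet e1 e2) v2 (t1 + t2 + vsize v2)
| EvalCall env f e body x v t1 t2 :
    onth p f = Some body ->
    eval p env e x t1 -> eval p [:: x] body v t2 ->
    eval p env (ECall f e) v (t1 + t2 + vsize v).

Definition runs (p : program) (x y : value) (t : nat) : Prop :=
  eval p [:: x] (ECall 0 (EVar 0)) y t.

Lemma eval_det p env e v t v' t' :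
  eval p env e v t -> eval p env e v' t' -> v = v' /\ t = t'.
Proof.
move=> H; elim: H v' t' => {env e v t}.
- by move=> env i v Hv v' t' H; inversion H; subst; split; congruence.
- by move=> env z v' t' H; inversion H.
- move=> env o e1 e2 x y t1 t2 _ IH1 _ IH2 v' t' H; inversion H; subst.
  by have [[<-] <-] := IH1 _ _ ltac:(eassumption);
     have [[<-] <-] := IH2 _ _ ltac:(eassumption).
- move=> env e1 e2 v1 v2 t1 t2 _ IH1 _ IH2 v' t' H; inversion H; subst.
  by have [<- <-] := IH1 _ _ ltac:(eassumption);
     have [<- <-] := IH2 _ _ ltac:(eassumption).
- move=> env e v1 v2 t _ IH v' t' H; inversion H; subst.
  by have [[<- _] <-] := IH _ _ ltac:(eassumption).
- move=> env e v1 v2 t _ IH v' t' H; inversion H; subst.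
  by have [[_ <-] <-] := IH _ _ ltac:(eassumption).
- move=> env e e1 e2 b v tb t _ IHb _ IH v' t' H; inversion H; subst.
  have [Eb <-] := IHb _ _ ltac:(eassumption); subst.
  by have [<- <-] := IH _ _ ltac:(eassumption).
- move=> env e1 e2 v1 v2 t1 t2 _ IH1 _ IH2 v' t' H; inversion H; subst.
  have [E1 <-] := IH1 _ _ ltac:(eassumption); subst.
  by have [<- <-] := IH2 _ _ ltac:(eassumption).
- move=> env f e body x v t1 t2 Hf _ IH1 _ IH2 v' t' H; inversion H; subst.
  have [E1 <-] := IH1 _ _ ltac:(eassumption).
  have Eb : body = body0 by congruence.
  by subst; have [<- <-] := IH2 _ _ ltac:(eassumption).
Qed.

(** * Instances of preemptive throughput maximization

   Requirements and profits are rational, so that instances are finite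
   objects. *)

Record job := Job {
  release : int;
  deadline : int;
  proc : nat;
  demand : rat;
  profit : rat
}.

Record instance := Instance {
  hosts : nat;
  njobs : nat;
  jobs : njobs.-tuple job
}.

Definition job_at (I : instance) (j : 'I_(njobs I)) : job := tnth (jobs I) j.

Definition window (j : job) : pred int :=
  [pred t | release j <= t <= deadline j].

Definition window_length (j : job) : int := deadline j - release j + 1.

Definition wf_job (j : job) : Prop :=
  [/\ release j <= deadline j, (0 < proc j)%N, 0 < demand j <= 1
    & 0 <= profit j].

Definition wf_instance (I : instance) : Prop :=
  (0 < hosts I)%N /\ forall j : 'I_(njobs I), wf_job (job_at j).

Definition nested_or_disjoint (A B : pred int) : Prop :=
  [\/ {subset A <= B}, {subset B <= A} | forall t, ~ (t \in A /\ t \in B)].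

Definition laminar (I : instance) : Prop :=
  forall j j' : 'I_(njobs I),
    nested_or_disjoint (window (job_at j)) (window (job_at j')).

Definition slack (R : realType) (lam : R) (I : instance) : Prop :=
  forall j : 'I_(njobs I),
    (proc (job_at j))%:R <= lam * (window_length (job_at j))%:~R.

Definition schedule (I : instance) : Type :=
  'I_(hosts I) -> int -> {set 'I_(njobs I)}.

Definition is_schedule_of (I : instance) (S : {set 'I_(njobs I)})
    (sigma : schedule I) : Prop :=
  [/\ forall i t, sigma i t \subset S,
      forall i t j, j \in sigma i t -> t \in window (job_at j),
      forall i t, \sum_(j in sigma i t) demand (job_at j) <= 1,
      forall i i' t j, j \in sigma i t -> j \in sigma i' t -> i = i'
    & forall j, j \in S -> exists T : seq int,
        [/\ uniq T, (proc (job_at j) <= size T)%N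
          & forall t, t \in T ->
              t \in window (job_at j) /\ exists i, j \in sigma i t]].

Definition feasible (I : instance) (S : {set 'I_(njobs I)}) : Prop :=
  exists sigma : schedule I, is_schedule_of S sigma.

Definition total_profit (I : instance) (S : {set 'I_(njobs I)}) : rat :=
  \sum_(j in S) profit (job_at j).

(** * Solutions as finite objects

   Slots are given in binary, so the number of slots may be exponential in the
   length of the instance.  A schedule is therefore written as a list of
   blocks, each placing one job on one host during all slots of an interval
   (empty if [bstop < bstart]). *)

Record block (I : instance) := Block {
  bjob : 'I_(njobs I);
  bhost : 'I_(hosts I);
  bstart : int;
  bstop : int
}.

Definition schedule_of_blocks (I : instance) (B : seq (block I)) : schedule I :=
  fun i t => [set j | has (fun b =>
    [&& bjob b == j, bhost b == i & bstart b <= t <= bstop b]) B].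

Definition enc_seq (T : Type) (enc : T -> value) (s : seq T) : value :=
  foldr (fun x v => VPair (enc x) v) (VInt 0) s.

Definition enc_nat (n : nat) : value := VInt n%:Z.

Definition enc_rat (q : rat) : value := VPair (VInt (numq q)) (VInt (denq q)).

Definition enc_job (j : job) : value :=
  VPair (VInt (release j)) (VPair (VInt (deadline j)) (VPair (enc_nat (proc j))
    (VPair (enc_rat (demand j)) (enc_rat (profit j))))).

Definition enc_instance (I : instance) : value :=
  VPair (enc_nat (hosts I)) (enc_seq enc_job (jobs I)).

Definition enc_block (I : instance) (b : block I) : value :=
  VPair (enc_nat (bjob b)) (VPair (enc_nat (bhost b))
    (VPair (VInt (bstart b)) (VInt (bstop b)))).

Definition enc_solution (I : instance) (s : seq 'I_(njobs I))
    (B : seq (block I)) : value :=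
  VPair (enc_seq (fun j : 'I_(njobs I) => enc_nat j) s) (enc_seq (@enc_block I) B).

(** * Polynomial-time approximation *)

Definition polytime_on (p : program) (P : instance -> Prop) : Prop :=
  exists a k : nat, forall I, P I ->
    exists y t, runs p (enc_instance I) y t
      /\ (t <= a * vsize (enc_instance I) ^ k)%N.

Definition approximates (p : program) (c : rat) (P : instance -> Prop) : Prop :=
  forall I, P I -> forall y t, runs p (enc_instance I) y t ->
    exists (s : seq 'I_(njobs I)) (B : seq (block I)),
      let S := [set j in s] in
      [/\ y = enc_solution s B,
          is_schedule_of S (schedule_of_blocks B)
        & forall S' : {set 'I_(njobs I)}, feasible S' ->
            c * total_profit S' <= total_profit S].

(* Main.v *)
From HB Require Import structures.
Require Import Defs.
From mathcomp Require Import all_boot all_order all_algebra.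
From mathcomp Require Import reals.
From mathcomp Require Import zify ring lra.
Set Implicit Arguments.
Unset Strict Implicit.
Unset Printing Implicit Defensive.
Import Order.TTheory GRing.Theory Num.Theory.
Local Open Scope ring_scope.

(** The jobs of demand at most 1/2 and the other ones, whose demand is rounded up
    to 1, are treated separately, and the better of the two solutions is returned.

    In each class the jobs are processed by decreasing window length following the
    local-ratio method.  The first job x, of residual profit f > 0, lowers the
    residual profit of each job i with a window inside that of x by
    K f s_i p_i / (m |chi_x|), where K >= 2 / (1 - lam); the remaining jobs are
    solved recursively and x is added to the solution if it fits.  A feasible set
    loses at most (1 + K) f in this step, since its jobs inside chi_x have total
    area at most m |chi_x|.  The computed solution gains at least f: either x is
    added, or placing x failed.  In the latter case more than (1 - lam) |chi_x|
    slots of chi_x are saturated.  As the hosts of a slot are filled by next fit,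
    a saturated slot is loaded to at least m/2, so the jobs already placed in
    chi_x have area at least m |chi_x| / K.  By laminarity and the processing
    order these jobs have windows inside chi_x.

    A schedule is kept as a partition of the time line into segments on which the
    load is constant, so that the running time does not depend on the number of
    slots; the profits are scaled by m |chi_x| and a common denominator Q in order
    to stay integral. *)

(** * Cost of a run from its number of calls *)

(** Next fit makes the schedule compressible: the loads of a slot reduce to two integers, the index
    and the load of the current host, and a job adds at most three segments, two by cutting at the
    ends of its window and one where its processing ends. The half-load argument needs that a job
    which does not fit finds the current host at least half full. This holds if all demands are at
    most 1/2, and also if all are equal to 1, since hosts are then empty or full; a mixture would
    break it, hence the two classes. Rounding up costs nothing, as two jobs of demand above 1/2
    never share a host in a slot; the split into classes costs the factor 2 in the ratio 2 (1 + K).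
    The other obstacle is the length of the numbers: each local-ratio step multiplies the residual
    profits by m Q |chi_x|, but there are at most as many steps as jobs, so bit lengths stay
    quadratic. The cost of a run follows from three separate bounds: on the number of calls, on the
    leaves of the values and on the integers. *)

Section CostModel.

Local Open Scope nat_scope.

(* [vgrowth e * B] bounds the values computed by [e] when the environment and
   the results of the calls have size at most [B]; [tgrowth e * B] bounds the
   cost of [e] apart from that of the calls. *)
Fixpoint vgrowth (e : expr) : nat :=
  match e with
  | EVar _ => 1
  | EInt z => vsize (VInt z)
  | EPrim _ e1 e2 => vgrowth e1 + vgrowth e2 + 2
  | EPair e1 e2 => (vgrowth e1 + vgrowth e2).+1
  | EFst e1 | ESnd e1 => vgrowth e1
  | EIf _ e1 e2 => vgrowth e1 + vgrowth e2
  | ELet e1 e2 => vgrowth e1 * vgrowth e2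
  | ECall _ _ => 1
  end.

Fixpoint tgrowth (e : expr) : nat :=
  vgrowth e +
  match e with
  | EVar _ | EInt _ => 0
  | EPrim _ e1 e2 | EPair e1 e2 => tgrowth e1 + tgrowth e2
  | EFst e1 => tgrowth e1
  | ESnd e1 => tgrowth e1
  | EIf e1 e2 e3 => tgrowth e1 + tgrowth e2 + tgrowth e3
  | ELet e1 e2 => tgrowth e1 + vgrowth e1 * tgrowth e2
  | ECall _ e1 => tgrowth e1
  end.

Lemma vgrowth_gt0 e : 0 < vgrowth e.
Proof. by elim: e => //= *; lia. Qed.

Lemma vsize_gt0 v : 0 < vsize v. Proof. by case: v. Qed.

Lemma absz_lt_exp (z : int) : `|z|%N < 2 ^ (trunc_log 2 `|z|%N).+1.
Proof. exact: trunc_log_ltn. Qed.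

Lemma trunc_log_leq_exp n k : n < 2 ^ k.+1 -> trunc_log 2 n <= k.
Proof.
case: n => [|n] nk; first by rewrite trunc_log0.
by rewrite -ltnS -(@ltn_exp2l 2) // (leq_ltn_trans _ nk) // trunc_logP.
Qed.

Lemma vsize_apply_prim o x y :
  vsize (VInt (apply_prim o x y)) <= vsize (VInt x) + vsize (VInt y) + 2.
Proof.
have Hx := absz_lt_exp x; have Hy := absz_lt_exp y.
set a := trunc_log 2 `|x|%N in Hx *; set b := trunc_log 2 `|y|%N in Hy *.
have addb z : `|z|%N <= `|x|%N + `|y|%N ->
    (trunc_log 2 `|z|%N).+2 <= a.+2 + b.+2 + 2.
  move=> Hz.
  suff: trunc_log 2 `|z|%N <= a + b + 1 by lia.
  apply: trunc_log_leq_exp.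
  have -> : (a + b + 1).+1 = a.+1 + b.+1 by lia.
  rewrite expnD.
  have := ltn_expl a.+1 (isT : 1 < 2); have := ltn_expl b.+1 (isT : 1 < 2).
  move: (2 ^ a.+1) (2 ^ b.+1) Hx Hy => A B Hx Hy A2 B2.
  (* Both powers are at least 2, so the sum of the magnitudes is at most the product, whose bit
     length is additive. *)
  have : A + B <= A * B; last by lia.
  by move: A2 B2; clear; case: A => [|[|A]] //; case: B => [|[|B]] // _ _; nia.
case: o => /=.
- by apply: addb; lia.
- by apply: addb; lia.
- suff: trunc_log 2 `|(x * y)%R|%N <= a + b + 1 by lia.
  apply: trunc_log_leq_exp.
  have -> : (a + b + 1).+1 = a.+1 + b.+1 by lia.
  by rewrite abszM expnD ltn_mul.
(* Division by 0 gives 0. Otherwise the remainder [r] satisfies [0 <= r < |y|], and a nonzero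
   quotient has [|q| <= |q * y + r|]. *)
- apply: addb; apply: leq_trans (leq_addr _ _).
  have [->|y0] := eqVneq y 0%R; first by rewrite divz0.
  have := divz_eq x y; have := modz_ge0 x y0; have := ltz_mod x y0.
  move: (x %/ y)%Z (x %% y)%Z => q r rlt r0 ->.
  have [->|q0] := eqVneq q 0%R; first by [].
  have q1 : (1 <= `|q|)%R by rewrite -gtz0_ge1 normr_gt0.
  have y1 : (1 <= `|y|)%R by rewrite -gtz0_ge1 normr_gt0.
  have qy : (`|q| * `|y| = q * y \/ `|q| * `|y| = - (q * y))%R.
    by rewrite -normrM; case: (lerP 0 (q * y)%R) => ?; [left; rewrite ger0_norm|right; rewrite ltr0_norm].
  have : (`|q| <= `|q * y + r|)%R by move: (`|q|)%R (`|y|)%R (q * y)%R q1 y1 qy rlt r0; clear; nia.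
  by lia.
- by case: ifP.
Qed.

Section Cost.

Variable p : program.

Definition table_cost : nat := \sum_(e <- p) tgrowth e.

Variable B : nat.

(* [callb f x v k]: function [f] maps [x] to [v] by an execution tree of at most
   [k] calls, whose arguments and results all have size at most [B]. *)
Definition callb (f : nat) (x v : value) (k : nat) : Prop :=
  [/\ vsize x <= B, vsize v <= B & exists body t,
     [/\ onth p f = Some body, eval p [:: x] body v t
       & t + vsize v <= k * ((table_cost).+1 * B)]].

(* The number passed to [Q] counts the calls. *)
Fixpoint wp (e : expr) (env : seq value) (Q : value -> nat -> Prop) : Prop :=
  match e with
  | EVar i => if onth env i is Some v then Q v 0 else False
  | EInt z => Q (VInt z) 0
  | EPrim o e1 e2 => wp e1 env (fun v1 n1 => wp e2 env (fun v2 n2 =>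
      if v1 is VInt x then
        if v2 is VInt y then Q (VInt (apply_prim o x y)) (n1 + n2) else False
      else False))
  | EPair e1 e2 => wp e1 env (fun v1 n1 => wp e2 env (fun v2 n2 =>
      Q (VPair v1 v2) (n1 + n2)))
  | EFst e1 => wp e1 env (fun v n => if v is VPair v1 _ then Q v1 n else False)
  | ESnd e1 => wp e1 env (fun v n => if v is VPair _ v2 then Q v2 n else False)
  | EIf e1 e2 e3 => wp e1 env (fun b n =>
      if truthy b then wp e2 env (fun v k => Q v (n + k))
      else wp e3 env (fun v k => Q v (n + k)))
  | ELet e1 e2 => wp e1 env (fun v1 n =>
      wp e2 (v1 :: env) (fun v k => Q v (n + k)))
  | ECall f e1 => wp e1 env (fun x n =>
      exists v k, callb f x v k /\ Q v (n + k))
  end.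

(** The bound [D] on the environment is separate from [B] because a let extends the environment by a
    value of size up to [vgrowth e1 * D], while arguments and results of calls remain bounded by
    [B]. [callb] gives every call the same budget, so only the number of calls matters. *)
Lemma wp_sound e env Q D : B <= D -> 0 < D -> all (fun v => vsize v <= D) env ->
  wp e env Q -> exists v n t, [/\ eval p env e v t, Q v n, vsize v <= vgrowth e * D
    & t <= tgrowth e * D + n * (table_cost.+1 * B)].
Proof.
set C := _ * B.
elim: e env Q D => [i|z|o e1 IH1 e2 IH2|e1 IH1 e2 IH2|e IH|e IH|e1 IH1 e2 IH2 e3 IH3
  |e1 IH1 e2 IH2|f e IH] env Q D BD D0 Henv /=.
- case E: (onth env i) => [v|] // HQ; exists v, 0, (vsize v).
  have vD : vsize v <= D.
    have iE : i < size env by rewrite -onthTE E.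
    by move/(all_nthP v): Henv => /(_ i iE); rewrite (onth_nth v _ _ _ E).
  by split=> //; [constructor|lia|nia].
- move=> HQ; exists (VInt z), 0, (vsize (VInt z)); split=> //.
  + by constructor.
  + by move=> /=; nia.
  + by move=> /=; nia.
- move=> /(IH1 _ _ _ BD D0 Henv)[v1 [n1 [t1 [E1 + s1 c1]]]].
  move=> /(IH2 _ _ _ BD D0 Henv)[v2 [n2 [t2 [E2 + s2 c2]]]].
  case: v1 E1 s1 => // x E1 s1; case: v2 E2 s2 => // y E2 s2 HQ.
  have := vsize_apply_prim o x y; set w := VInt (apply_prim o x y) => Hw.
  have Hw' : vsize w <= (vgrowth e1 + vgrowth e2 + 2) * D.
    by apply: leq_trans Hw _; rewrite !mulnDl; lia.
  exists w, (n1 + n2), (t1 + t2 + vsize w); split=> //; first by constructor.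
  by move: Hw' c1 c2; rewrite !mulnDl; lia.
- move=> /(IH1 _ _ _ BD D0 Henv)[v1 [n1 [t1 [E1 + s1 c1]]]].
  move=> /(IH2 _ _ _ BD D0 Henv)[v2 [n2 [t2 [E2 HQ s2 c2]]]].
  have Hw' : vsize (VPair v1 v2) <= (vgrowth e1 + vgrowth e2).+1 * D.
    by rewrite /= mulSn mulnDl; lia.
  exists (VPair v1 v2), (n1 + n2), (t1 + t2 + vsize (VPair v1 v2)); split=> //.
    by constructor.
  by move: Hw' c1 c2; rewrite !(mulnDl, mulSn); lia.
- move=> /(IH _ _ _ BD D0 Henv)[v [n1 [t1 [E1 + s1 c1]]]].
  case: v E1 s1 => // v1 v2 E1 /= s1 HQ.
  exists v1, n1, (t1 + vsize v1); split=> //; first exact: EvalFst E1.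
  + by lia.
  + by rewrite mulnDl; lia.
- move=> /(IH _ _ _ BD D0 Henv)[v [n1 [t1 [E1 + s1 c1]]]].
  case: v E1 s1 => // v1 v2 E1 /= s1 HQ.
  exists v2, n1, (t1 + vsize v2); split=> //; first exact: EvalSnd E1.
  + by lia.
  + by rewrite mulnDl; lia.
- move=> /(IH1 _ _ _ BD D0 Henv)[b [n1 [t1 [E1 + s1 c1]]]].
  case Eb: (truthy b).
  + move=> /(IH2 _ _ _ BD D0 Henv)[v [n [t [E2 HQ s c]]]].
    exists v, (n1 + n), (t1 + t + vsize v); split=> //.
    * by apply: (EvalIf E1); rewrite Eb.
    * by rewrite mulnDl; lia.
    * by move: c1 c; rewrite !mulnDl; lia.
  + move=> /(IH3 _ _ _ BD D0 Henv)[v [n [t [E2 HQ s c]]]].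
    exists v, (n1 + n), (t1 + t + vsize v); split=> //.
    * by apply: (EvalIf E1); rewrite Eb.
    * by rewrite mulnDl; lia.
    * by move: c1 c; rewrite !mulnDl; lia.
- move=> /(IH1 _ _ _ BD D0 Henv)[v1 [n1 [t1 [E1 W2 s1 c1]]]].
  have g1 := vgrowth_gt0 e1.
  have DD : D <= vgrowth e1 * D by rewrite leq_pmull.
  case: (IH2 _ _ (vgrowth e1 * D) _ _ _ W2); [lia|lia| |].
    by rewrite /= s1; apply: sub_all Henv => v /= ?; lia.
  move=> v [n [t [E2 HQ s c]]].
  exists v, (n1 + n), (t1 + t + vsize v); split=> //.
  + exact: EvalLet E1 E2.
  + by rewrite -mulnA mulnCA.
  + move: c1 c s; rewrite !mulnDl !mulnA [vgrowth e2 * _]mulnC [tgrowth e2 * _]mulnC.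
    by lia.
- move=> /(IH _ _ _ BD D0 Henv)[x [n1 [t1 [E1 [v [k [[sx sv [body [t [Ef Eb Ht]]]] HQ]]] s1 c1]]]].
  exists v, (n1 + k), (t1 + t + vsize v); split=> //.
  + exact: EvalCall Ef E1 Eb.
  + by lia.
  + by move: c1 Ht; rewrite -/C !mulnDl; lia.
Qed.

(** The strict [n < k] leaves one unit for the call itself: the work of [body] outside of its calls,
    together with the result, costs at most [table_cost.+1 * B]. *)
Lemma callbI f body x v k : onth p f = Some body ->
  vsize x <= B -> vsize v <= B ->
  wp body [:: x] (fun v' n => v' = v /\ n < k) -> callb f x v k.
Proof.
move=> Ef sx sv /(@wp_sound _ _ _ B (leqnn B)) []; first by have := vsize_gt0 x; lia.
  by rewrite /= sx.
move=> v' [n [t [Eb [vE nk] _ Ht]]]; rewrite vE in Eb; split=> //; exists body, t; split=> //.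
have Hb : tgrowth body <= table_cost.
  have fE : f < size p by rewrite -onthTE Ef.
  rewrite -{1}(onth_nth body _ _ _ Ef).
  by rewrite /table_cost (big_nth body) big_mkord (bigD1 (Ordinal fE)) //= leq_addr.
have : n.+1 * (table_cost.+1 * B) <= k * (table_cost.+1 * B) by rewrite leq_mul2r nk orbT.
rewrite mulSn {2}mulSn; have : tgrowth body * B <= table_cost * B by rewrite leq_mul2r Hb orbT.
by lia.
Qed.

Lemma callb_leq f x v k k' : callb f x v k -> k <= k' -> callb f x v k'.
Proof.
move=> [sx sv [body [t [Ef Eb Ht]]]] kk'; split=> //; exists body, t; split=> //.
by apply: leq_trans Ht _; rewrite leq_mul2r kk' orbT.
Qed.

End Cost.

End CostModel.

(** * The algorithm *)

(* [xf] is the residual profit of the local-ratio scheme, [xw] the scaled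
   profit; [xs] is the demand in units of 1 / Q of a host. *)
Record item := Item {
  xi : int; xr : int; xd : int; xp : int; xs : int; xw : int; xf : int }.

(* On the slots [ga..gb], hosts [< gh] are closed, host [gh] has load [gl] and
   hosts [> gh] are empty. *)
Record segment := Segment { ga : int; gb : int; gh : int; gl : int }.

(* [kc] is the demand of the job; it is not part of the output. *)
Record piece := Piece { kj : int; kh : int; ka : int; kb : int; kc : int }.

Record state := State {
  segs : seq segment; pieces : seq piece; chosen : seq int; gain : int }.

Lemma item_tupleK : cancel
  (fun x => (xi x, xr x, xd x, xp x, xs x, xw x, xf x))
  (fun u => let: (i, r, d, p, s, w, f) := u in Item i r d p s w f).
Proof. by case. Qed.
HB.instance Definition _ := Equality.copy item (can_type item_tupleK).

Lemma segment_tupleK : cancel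
  (fun g => (ga g, gb g, gh g, gl g)) (fun u => let: (a, b, h, l) := u in Segment a b h l).
Proof. by case. Qed.
HB.instance Definition _ := Equality.copy segment (can_type segment_tupleK).

Lemma piece_tupleK : cancel
  (fun k => (kj k, kh k, ka k, kb k, kc k))
  (fun u => let: (j, h, a, b, c) := u in Piece j h a b c).
Proof. by case. Qed.
HB.instance Definition _ := Equality.copy piece (can_type piece_tupleK).

Definition xlen (x : item) : int := xd x - xr x + 1.

Fixpoint insert (x : item) (s : seq item) : seq item :=
  if s is y :: s' then
    if xlen y <= xlen x then x :: s else y :: insert x s'
  else [:: x].

Definition reweight (r d g D : int) (x : item) : item :=
  Item (xi x) (xr x) (xd x) (xp x) (xs x) (xw x)
    (if (r <= xr x) && (xd x <= d)
     then xf x * D - g * (xs x * xp x) else xf x * D).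

(** Afterwards no segment contains both [c - 1] and [c]. A segment starting at [c] is left alone, so
    no empty segment arises. *)
Fixpoint cut (c : int) (s : seq segment) : seq segment :=
  if s is g :: s' then
    if (ga g + 1 <= c) && (c <= gb g) then
      Segment (ga g) (c - 1) (gh g) (gl g) ::
      Segment c (gb g) (gh g) (gl g) :: cut c s'
    else g :: cut c s'
  else [::].

Section Algorithm.

Variables m Q : int.

Definition fits (s l : int) : bool := l + s <= Q.

(** Hosts are numbered from 0, so host [gh g + 1] can be opened only if [gh g + 2 <= m]. *)
Definition eligible (x : item) (g : segment) : bool :=
  [&& xr x <= ga g, gb g <= xd x & fits (xs x) (gl g) || (gh g + 2 <= m)].

Definition bump_h (s h l : int) : int := if fits s l then h else h + 1.
Definition bump_l (s l : int) : int := if fits s l then l + s else s.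

(* The result is (processing time left, segments, new pieces). *)
Fixpoint fill (x : item) (p : int) (s : seq segment) :
    int * (seq segment * seq piece) :=
  if s is g :: s' then
    if p <= 0 then (p, (s, [::])) else
    if eligible x g then
      let h := bump_h (xs x) (gh g) (gl g) in
      let l := bump_l (xs x) (gl g) in
      if gb g - ga g + 1 <= p then
        let: (q, (t, k)) := fill x (p - (gb g - ga g + 1)) s' in
        (q, (Segment (ga g) (gb g) h l :: t,
             Piece (xi x) h (ga g) (gb g) (xs x) :: k))
      else
        (0, (Segment (ga g) (ga g + p - 1) h l ::
             Segment (ga g + p) (gb g) (gh g) (gl g) :: s',
             [:: Piece (xi x) h (ga g) (ga g + p - 1) (xs x)]))
    else
      let: (q, (t, k)) := fill x p s' in (q, (g :: t, k))
  else (p, ([::], [::])).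

Definition place (x : item) (st : state) : state :=
  let: (q, (t, k)) := fill x (xp x) (cut (xd x + 1) (cut (xr x) (segs st))) in
  if q <= 0 then
    State t (k ++ pieces st) (xi x :: chosen st) (gain st + xw x)
  else st.

(* An upper bound of 2 / (1 - lam). *)
Variable K : int.

Definition reweights (x : item) : seq item -> seq item :=
  map (reweight (xr x) (xd x) (K * xf x) (m * Q * xlen x)).

(** [n] is fuel, since the recursion is on a reweighted list and not on a subterm. The initial
    segment from [- Q] to [Q] stands for the whole time line, as [Q] dominates all dates. *)
Fixpoint solve_rec (n : nat) (s : seq item) : state :=
  match n, s with
  | n'.+1, x :: s' =>
      if xf x <= 0 then solve_rec n' s'
      else place x (solve_rec n' (reweights x s'))
  | _, _ => State [:: Segment (- Q) Q 0 0] [::] [::] 0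
  end.

Definition solve (s : seq item) : state := solve_rec (size s) s.

End Algorithm.

(** The denominators make scaled demands and profits integral; the quadratic factor exceeds the
    absolute values of both dates. One product thus serves as common denominator, as host capacity
    and as bound of the time line. *)
Definition scale_factor (j : job) : int :=
  denq (demand j) * denq (profit j) *
  (1 + release j * release j + deadline j * deadline j).

Fixpoint scale (s : seq job) : int :=
  if s is j :: s' then scale_factor j * scale s' else 1.

Definition narrow (j : job) : bool :=
  numq (demand j) + numq (demand j) <= denq (demand j).

(* A wide job is rounded up to a whole host. *)
Definition item_of (c : bool) (Q i : int) (j : job) : item :=
  let w := (numq (profit j) * Q %/ denq (profit j))%Z in
  Item i (release j) (deadline j) (proc j)%:Z
    (if c then (numq (demand j) * Q %/ denq (demand j))%Z else Q) w w.

Fixpoint items (c : bool) (Q i : int) (s : seq job) : seq item :=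
  if s is j :: s' then
    let t := items c Q (i + 1) s' in
    if narrow j == c then insert (item_of c Q i j) t else t
  else [::].

Definition best (a b : state) : state := if gain b <= gain a then a else b.

Definition answer (K : int) (I : instance) : state :=
  let Q := scale (jobs I) in
  let run c := solve (hosts I)%:Z Q K (items c Q 0 (jobs I)) in
  best (run true) (run false).

(** * The program *)

(* Each body below is preceded by the shape of its argument, which is variable 0
   outside of the scope of [ELet]. *)

Definition enc_item (x : item) : value :=
  VPair (VInt (xi x)) (VPair (VInt (xr x)) (VPair (VInt (xd x))
    (VPair (VInt (xp x)) (VPair (VInt (xs x)) (VPair (VInt (xw x))
    (VInt (xf x))))))).

Definition enc_segment (g : segment) : value :=
  VPair (VInt (ga g)) (VPair (VInt (gb g)) (VPair (VInt (gh g)) (VInt (gl g)))).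

Definition enc_piece (k : piece) : value :=
  VPair (VInt (kj k)) (VPair (VInt (kh k)) (VPair (VInt (ka k)) (VInt (kb k)))).

Definition enc_state (st : state) : value :=
  VPair (enc_seq enc_segment (segs st)) (VPair (enc_seq enc_piece (pieces st))
    (VPair (enc_seq VInt (chosen st)) (VInt (gain st)))).

Definition etl (k : nat) (e : expr) : expr := iter k ESnd e.
Definition enth (k : nat) (e : expr) : expr := EFst (etl k e).
Definition eand (a b : expr) : expr := EIf a b (EInt 0).
Definition eor (a b : expr) : expr := EIf a (EInt 1) b.
Definition eadd := EPrim Add.
Definition esub := EPrim Defs.Sub.
Definition emul := EPrim Mul.
Definition ele := EPrim Leq.
Definition e1 := EInt 1.
Definition e0 := EInt 0.
Definition v0 := EVar 0.
Definition v1 := EVar 1.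

Definition f_scale := 1%N.
Definition f_insert := 2%N.
Definition f_items := 3%N.
Definition f_reweight := 4%N.
Definition f_cut := 5%N.
Definition f_fill := 6%N.
Definition f_place := 7%N.
Definition f_solve := 8%N.

(* Length of the window of the item, resp. segment, [e] whose first bound is
   its component [k]. *)
Definition elen (k : nat) (e : expr) : expr :=
  eadd (esub (enth k.+1 e) (enth k e)) e1.

(* jobs *)
Definition b_scale : expr :=
  EIf v0
    (emul
       (let j := EFst v0 in
        emul (emul (ESnd (enth 3 j)) (ESnd (etl 4 j)))
          (eadd (eadd e1 (emul (enth 0 j) (enth 0 j)))
             (emul (enth 1 j) (enth 1 j))))
       (ECall f_scale (ESnd v0)))
    e1.

(* (item, items) *)
Definition b_insert : expr :=
  let x := EFst v0 in let s := ESnd v0 in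
  EIf s
    (EIf (ele (elen 1 (EFst s)) (elen 1 x))
       (EPair x s)
       (EPair (EFst s) (ECall f_insert (EPair x (ESnd s)))))
    (EPair x e0).

(* (class, (Q, (index, jobs))) *)
Definition b_items : expr :=
  let t := etl 3 v0 in
  EIf t
    (ELet (ECall f_items (EPair (EFst v0) (EPair (enth 1 v0)
             (EPair (eadd (enth 2 v0) e1) (ESnd t)))))
       (let a := v1 in let j := EFst (etl 3 a) in
        let c := EFst a in let q := enth 1 a in
        let num := EFst (enth 3 j) in let den := ESnd (enth 3 j) in
        let nar := ele (eadd num num) den in
        let w := EPrim Div (emul (EFst (etl 4 j)) q) (ESnd (etl 4 j)) in
        EIf (EIf c nar (EIf nar e0 e1))
          (ECall f_insert (EPair
             (EPair (enth 2 a) (EPair (enth 0 j) (EPair (enth 1 j)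
               (EPair (enth 2 j) (EPair
                  (EIf c (EPrim Div (emul num q) den) q) (EPair w w))))))
             v0))
          v0))
    e0.

(* (r, (d, (g, (D, items)))) *)
Definition b_reweight : expr :=
  let s := etl 4 v0 in
  EIf s
    (let x := EFst s in
     let fD := emul (etl 6 x) (enth 3 v0) in
     EPair
       (EPair (enth 0 x) (EPair (enth 1 x) (EPair (enth 2 x) (EPair (enth 3 x)
         (EPair (enth 4 x) (EPair (enth 5 x)
           (EIf (eand (ele (enth 0 v0) (enth 1 x)) (ele (enth 2 x) (enth 1 v0)))
              (esub fD (emul (enth 2 v0) (emul (enth 4 x) (enth 3 x))))
              fD)))))))
       (ECall f_reweight (EPair (enth 0 v0) (EPair (enth 1 v0)
          (EPair (enth 2 v0) (EPair (enth 3 v0) (ESnd s)))))))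
    e0.

(* (c, segments) *)
Definition b_cut : expr :=
  let c := EFst v0 in let s := ESnd v0 in
  EIf s
    (let g := EFst s in
     ELet (ECall f_cut (EPair c (ESnd s)))
       (let c := EFst v1 in let g := EFst (ESnd v1) in
        EIf (eand (ele (eadd (enth 0 g) e1) c) (ele c (enth 1 g)))
          (EPair (EPair (enth 0 g) (EPair (esub c e1) (etl 2 g)))
            (EPair (EPair c (ESnd g)) v0))
          (EPair g v0)))
    e0.

(* ((m, Q), (item, (p, (segments, pieces)))) *)
Definition b_fill : expr :=
  let cfg := enth 0 v0 in let x := enth 1 v0 in let p := enth 2 v0 in
  let s := enth 3 v0 in let acc := etl 4 v0 in
  let g := EFst s in
  let fit := ele (eadd (etl 3 g) (enth 4 x)) (ESnd cfg) in
  let hl := EIf fit (EPair (enth 2 g) (eadd (etl 3 g) (enth 4 x)))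
              (EPair (eadd (enth 2 g) e1) (enth 4 x)) in
  EIf s
    (EIf (ele p e0) (EPair p (EPair s acc))
    (EIf (eand (ele (enth 1 x) (enth 0 g)) (eand (ele (enth 1 g) (enth 2 x))
           (eor fit (ele (eadd (enth 2 g) (EInt 2)) (EFst cfg)))))
       (EIf (ele (elen 0 g) p)
          (ELet (ECall f_fill (EPair cfg (EPair x (EPair (esub p (elen 0 g))
                   (EPair (ESnd s) acc)))))
             (let cfg := enth 0 v1 in let x := enth 1 v1 in
              let g := EFst (enth 3 v1) in
              let fit := ele (eadd (etl 3 g) (enth 4 x)) (ESnd cfg) in
              let hl := EIf fit (EPair (enth 2 g) (eadd (etl 3 g) (enth 4 x)))
                          (EPair (eadd (enth 2 g) e1) (enth 4 x)) in
              EPair (EFst v0)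
                (EPair (EPair (EPair (enth 0 g) (EPair (enth 1 g) hl)) (enth 1 v0))
                   (EPair (EPair (enth 0 x) (EPair (EFst hl)
                             (EPair (enth 0 g) (enth 1 g)))) (etl 2 v0)))))
          (let e := esub (eadd (enth 0 g) p) e1 in
           EPair e0
             (EPair (EPair (EPair (enth 0 g) (EPair e hl))
                      (EPair (EPair (eadd (enth 0 g) p) (ESnd g)) (ESnd s)))
                (EPair (EPair (enth 0 x) (EPair (EFst hl) (EPair (enth 0 g) e)))
                   acc))))
       (ELet (ECall f_fill (EPair cfg (EPair x (EPair p (EPair (ESnd s) acc)))))
          (EPair (EFst v0)
             (EPair (EPair (EFst (enth 3 v1)) (enth 1 v0)) (etl 2 v0))))))
    (EPair p (EPair e0 acc)).

(* ((m, Q), (item, state)) *)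
Definition b_place : expr :=
  let cfg := enth 0 v0 in let x := enth 1 v0 in let st := etl 2 v0 in
  ELet
    (ECall f_fill (EPair cfg (EPair x (EPair (enth 3 x) (EPair
       (ECall f_cut (EPair (eadd (enth 2 x) e1)
          (ECall f_cut (EPair (enth 1 x) (enth 0 st)))))
       (enth 1 st))))))
    (let x := enth 1 v1 in let st := etl 2 v1 in
     EIf (ele (EFst v0) e0)
       (EPair (enth 1 v0) (EPair (etl 2 v0)
          (EPair (EPair (enth 0 x) (enth 2 st)) (eadd (etl 3 st) (enth 5 x)))))
       st).

(* ((m, Q), items) *)
Definition b_solve (K : int) : expr :=
  let cfg := EFst v0 in let s := ESnd v0 in
  EIf s
    (let x := EFst s in
     EIf (ele (etl 6 x) e0)
       (ECall f_solve (EPair cfg (ESnd s)))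
       (ECall f_place (EPair cfg (EPair x
          (ECall f_solve (EPair cfg
             (ECall f_reweight (EPair (enth 1 x) (EPair (enth 2 x)
                (EPair (emul (EInt K) (etl 6 x))
                   (EPair (emul (emul (EFst cfg) (ESnd cfg)) (elen 1 x))
                      (ESnd s))))))))))))
    (EPair
       (EPair (EPair (esub e0 (ESnd cfg)) (EPair (ESnd cfg) (EPair e0 e0))) e0)
       (EPair e0 (EPair e0 e0))).

(* (m, jobs) *)
Definition b_main : expr :=
  ELet (ECall f_scale (ESnd v0))
  (let run k c := ECall f_solve (EPair (EPair (EFst (EVar k.+1)) (EVar k))
      (ECall f_items (EPair (EInt c) (EPair (EVar k)
         (EPair e0 (ESnd (EVar k.+1))))))) in
   ELet (run 0%N 1) (ELet (run 1%N 0)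
     (ELet (EIf (ele (etl 3 v0) (etl 3 v1)) v1 v0)
        (EPair (enth 2 v0) (enth 1 v0))))).

Definition prog (K : int) : program :=
  [:: b_main; b_scale; b_insert; b_items; b_reweight; b_cut; b_fill; b_place;
      b_solve K].

(** * Execution of the program *)

Fixpoint leaves (v : value) : nat :=
  if v is VPair v1 v2 then (leaves v1 + leaves v2)%N else 1%N.

Fixpoint ints (M : int) (v : value) : bool :=
  match v with
  | VInt z => `|z| <= M
  | VPair v1 v2 => ints M v1 && ints M v2
  end.

#[local] Arguments vsize : simpl never.

(** Separates size estimates into counting leaves and bounding integers. Of the summand 3, two come
    from the size of a leaf and one pays for the pair nodes, which are fewer than the leaves. *)
Lemma vsize_leaves M v : ints M v ->
  (vsize v < leaves v * (trunc_log 2 `|M| + 3))%N.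
Proof.
elim: v => [z|v1 IH1 v2 IH2]; rewrite /vsize /= -/vsize.
  move=> zM; have : (trunc_log 2 `|z| <= trunc_log 2 `|M|)%N by apply: leq_trunc_log; lia.
  by rewrite mul1n; lia.
by move=> /andP[/IH1 H1 /IH2 H2]; rewrite mulnDl; lia.
Qed.

Lemma leaves_seq T (enc : T -> value) c s : (forall x, leaves (enc x) = c) ->
  leaves (enc_seq enc s) = (size s * c).+1.
Proof. by move=> H; elim: s => //= x s ->; rewrite H mulSn addnS. Qed.

Lemma ints_seq T (enc : T -> value) M s : 0 <= M ->
  ints M (enc_seq enc s) = all (fun x => ints M (enc x)) s.
Proof. by move=> M0; elim: s => [|x s /= ->] //=; rewrite normr0. Qed.

Definition leaves_enc :=
  (fun s => @leaves_seq _ enc_item 7 s (fun=> erefl),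
   fun s => @leaves_seq _ enc_segment 4 s (fun=> erefl),
   fun s => @leaves_seq _ enc_piece 4 s (fun=> erefl),
   fun s => @leaves_seq _ VInt 1 s (fun=> erefl),
   fun s => @leaves_seq _ enc_job 7 s (fun=> erefl)).

Lemma ints_pair M v1 v2 : ints M (VPair v1 v2) = ints M v1 && ints M v2.
Proof. by []. Qed.

Lemma perm_insert x s : exists s1 s2, s = s1 ++ s2 /\ insert x s = s1 ++ x :: s2.
Proof.
elim: s => [|y s [s1 [s2 [E1 E2]]]] /=; first by exists [::], [::].
case: ifP => _; first by exists [::], (y :: s).
by exists (y :: s1), s2; rewrite E2 E1.
Qed.

Lemma size_insert x s : size (insert x s) = (size s).+1.
Proof.
by have [s1 [s2 [-> ->]]] := perm_insert x s; rewrite !size_cat /= addnS.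
Qed.

Lemma all_insert a x s : all a (insert x s) = a x && all a s.
Proof.
by have [s1 [s2 [-> ->]]] := perm_insert x s; rewrite !all_cat /= andbCA.
Qed.

Lemma size_items c Q i s : (size (items c Q i s) <= size s)%N.
Proof.
elim: s i => //= j s IH i; have := IH (i + 1).
by case: ifP => _; rewrite ?size_insert //; lia.
Qed.

Lemma size_cut c s : (size s <= size (cut c s))%N.
Proof. by elim: s => //= g s IH; case: ifP => _ /=; lia. Qed.

(** * Values and call counts of the functions of the table *)

Section Execution.

Variables (K M : int) (L : nat).
Hypothesis M1 : 1 <= M.

(** Generous enough for the leaves of every argument and result: these consist of a few lists, of
    lengths controlled by [L], of records with at most seven leaves. *)
Definition size_bound : nat := (16 * L + 60) * (trunc_log 2 `|M| + 3).

Notation call := (callb (prog K) size_bound).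

Let M0 : 0 <= M. Proof. by lia. Qed.

Lemma size_boundP v : (leaves v <= 16 * L + 60)%N -> ints M v ->
  (vsize v <= size_bound)%N.
Proof.
move=> Hl /vsize_leaves Hv; apply: ltnW; apply: leq_trans Hv _.
by rewrite leq_mul2r Hl orbT.
Qed.

Definition item_ok (x : item) : bool :=
  [&& ints M (enc_item x), 0 <= xp x & 0 <= xs x].

Definition segment_ok (g : segment) : bool :=
  [&& ints M (enc_segment g), ga g <= gb g, 0 <= gh g & 0 <= gl g].

Let item_ints s : all item_ok s -> ints M (enc_seq enc_item s).
Proof. by move=> H; rewrite ints_seq //; apply: sub_all H => x /and3P[]. Qed.

Let segment_ints s : all segment_ok s -> ints M (enc_seq enc_segment s).
Proof. by move=> H; rewrite ints_seq //; apply: sub_all H => x /andP[]. Qed.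

(** Like the other lemmas on calls: [callbI] leaves the sizes of argument and result to be bounded,
    and simplifying [wp] executes the body symbolically, the recursive call being answered by the
    induction hypothesis. *)
Lemma run_insert x s : item_ok x -> all item_ok s -> (size s < L)%N ->
  call f_insert (VPair (enc_item x) (enc_seq enc_item s))
    (enc_seq enc_item (insert x s)) (size s).+1.
Proof.
elim: s => [|y s IH] Hx Hs sL; apply: (@callbI _ _ _ b_insert) => //.
- by apply: size_boundP; [rewrite /= ; lia|case/and3P: Hx => /= -> _ _; rewrite normr0].
- by apply: size_boundP; [rewrite /= ; lia|case/and3P: Hx => /= -> _ _; rewrite normr0].
- apply: size_boundP; first by rewrite /= leaves_enc /=; simpl in sL; lia.
  by case/and3P: (Hx) => Hx1 _ _; rewrite ints_pair Hx1; apply: item_ints.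
- apply: size_boundP; first by rewrite leaves_enc size_insert /=; simpl in sL; lia.
  by apply: item_ints; rewrite all_insert Hx.
- rewrite /b_insert /elen /enth /etl /= -/(xlen _) -/(xlen _).
  case: (xlen y <= xlen x) => /=; first by split.
  exists (enc_seq enc_item (insert x s)), (size s).+1.
  by split=> //; apply: IH => //; [case/andP: Hs|simpl in sL; lia].
Qed.

(** The recursion computes the scale of every suffix, hence the hypothesis on all [drop i s]. *)
Lemma run_scale s : all (fun j => ints M (enc_job j)) s -> (size s <= L)%N ->
  (forall i, `|scale (drop i s)| <= M) ->
  call f_scale (enc_seq enc_job s) (VInt (scale s)) (size s).+1.
Proof.
elim: s => [|j s IH] Hs sL Hm; apply: (@callbI _ _ _ b_scale) => //.
- by apply: size_boundP; [rewrite /= ; lia|rewrite /= normr0].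
- by apply: size_boundP; [rewrite /= ; lia|exact: (Hm 0%N)].
- apply: size_boundP; first by rewrite leaves_enc /=; simpl in sL; lia.
  by rewrite ints_seq.
- by apply: size_boundP; [rewrite /= ; lia|exact: (Hm 0%N)].
- rewrite /b_scale /elen /enth /etl /=.
  exists (VInt (scale s)), (size s).+1; split=> //.
  by apply: IH => [||i]; [case/andP: Hs|simpl in sL; lia|exact: (Hm i.+1)].
Qed.

Lemma run_reweight r d g D s :
  [&& `|r| <= M, `|d| <= M, `|g| <= M & `|D| <= M] ->
  all item_ok s -> all item_ok (map (reweight r d g D) s) -> (size s <= L)%N ->
  call f_reweight
    (VPair (VInt r) (VPair (VInt d) (VPair (VInt g) (VPair (VInt D)
       (enc_seq enc_item s)))))
    (enc_seq enc_item (map (reweight r d g D) s)) (size s).+1.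
Proof.
move=> Hrd; elim: s => [|x s IH] Hs Ht sL; apply: (@callbI _ _ _ b_reweight) => //.
- by apply: size_boundP; [rewrite /= ; lia|move: Hrd; rewrite /= normr0 M0 andbT].
- by apply: size_boundP; [rewrite /= ; lia|rewrite /= normr0].
- apply: size_boundP; first by rewrite /= leaves_enc /=; simpl in sL; lia.
  by case/and4P: Hrd => H1 H2 H3 H4; rewrite 4!ints_pair item_ints //= H1 H2 H3 H4.
- apply: size_boundP; first by rewrite leaves_enc /= size_map; simpl in sL; lia.
  exact: item_ints.
- rewrite /b_reweight /elen /enth /etl /=.
  have IH' := IH (proj2 (andP Hs)) (proj2 (andP Ht)) (ltnW sL).
  rewrite /reweight /=; case: (r <= xr x) => /=; first case: (xd x <= d) => /=.
  all: exists (enc_seq enc_item (map (reweight r d g D) s)), (size s).+1.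
  all: by split; [|split=> //; lia].
Qed.

Lemma cut_ok c s : `|c| <= M -> all segment_ok s -> all segment_ok (cut c s).
Proof.
move=> cM; elim: s => //= g s IH /andP[Hg /IH Hs].
case: ifP => [/andP[c1 c2]|_] /=; rewrite Hs ?Hg ?andbT //.
by move: Hg; rewrite /segment_ok /=; clear -cM c1 c2; lia.
Qed.

Lemma run_cut c s : `|c| <= M -> all segment_ok s -> (size (cut c s) <= L)%N ->
  call f_cut (VPair (VInt c) (enc_seq enc_segment s))
    (enc_seq enc_segment (cut c s)) (size s).+1.
Proof.
move=> cM; elim: s => [|g s IH] Hs sL; apply: (@callbI _ _ _ b_cut) => //.
- by apply: size_boundP; [rewrite /= ; lia|rewrite /= normr0 cM].
- by apply: size_boundP; [rewrite /= ; lia|rewrite /= normr0].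
- apply: size_boundP.
    by rewrite /= leaves_enc /=; have := size_cut c (g :: s); rewrite [size (g :: s)]/=; lia.
  by rewrite ints_pair segment_ints // andbT.
- apply: size_boundP; first by rewrite leaves_enc; lia.
  by apply: segment_ints; apply: cut_ok.
- rewrite /b_cut /elen /enth /etl /=.
  exists (enc_seq enc_segment (cut c s)), (size s).+1; split.
    apply: IH; first by case/andP: Hs.
    by move: sL => /=; case: ifP => _ /=; lia.
  case: (ga g + 1 <= c) => /=; first case: (c <= gb g) => /=.
  all: by split=> //; lia.
Qed.

Lemma run_items (c : bool) Q i s :
  `|Q| <= M -> 0 <= Q -> `|i| + (size s)%:Z <= M ->
  all (fun j => ints M (enc_job j)) s -> (size s < L)%N ->
  all item_ok (items c Q i s) ->
  call f_items (VPair (VInt c%:Z) (VPair (VInt Q) (VPair (VInt i) (enc_seq enc_job s))))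
    (enc_seq enc_item (items c Q i s)) ((size s).+1 * (size s).+1).
Proof.
move=> QM Q0; elim: s i => [|j s IH] i iM Hs sL Hok.
  apply: (@callbI _ _ _ b_items) => //.
  - apply: size_boundP; first by rewrite /=; lia.
    by rewrite /= normr0 QM; case: c Hok => _; lia.
  - by apply: size_boundP; [rewrite /= ; lia|rewrite /= normr0].
have iM' : `|i + 1| + (size s)%:Z <= M by simpl in iM; lia.
have sL' : (size s < L)%N by simpl in sL; lia.
have Hs' : all (fun j => ints M (enc_job j)) s by case/andP: Hs.
have Hok' : all item_ok (items c Q (i + 1) s).
  by move: Hok => /=; case: ifP; rewrite ?all_insert // => _ /andP[].
have Hi := IH (i + 1) iM' Hs' sL' Hok'.
apply: (@callbI _ _ _ b_items) => //.
- apply: size_boundP; first by rewrite /= leaves_enc; lia.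
  rewrite 3!ints_pair ints_seq // Hs andbT /= QM /=; simpl in iM; case: c Hok {Hok' Hi IH} => _; lia.
- apply: size_boundP; first by rewrite leaves_enc; have := size_items c Q i (j :: s); simpl in *; lia.
  exact: item_ints.
rewrite /b_items /elen /enth /etl /=.
exists (enc_seq enc_item (items c Q (i + 1) s)), ((size s).+1 * (size s).+1)%N; split=> //.
have Hins : narrow j == c -> call f_insert
    (VPair (enc_item (item_of c Q i j)) (enc_seq enc_item (items c Q (i + 1) s)))
    (enc_seq enc_item (insert (item_of c Q i j) (items c Q (i + 1) s))) (size s).+1.
  move=> Hn; apply: callb_leq; first apply: run_insert => //.
  - by move: Hok; rewrite /= Hn all_insert => /andP[].
  - exact: leq_ltn_trans (size_items _ _ _ _) sL'.
  - by rewrite ltnS size_items.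
rewrite -/(narrow j) in Hins *.
case: c (narrow j) Hins {IH Hok Hok' Hi} => [] [] /= Hins.
- exists (enc_seq enc_item (insert (item_of true Q i j) (items true Q (i + 1) s))), (size s).+1.
  by split; [exact: Hins|split=> //; lia].
- by split=> //; lia.
- by split=> //; lia.
- exists (enc_seq enc_item (insert (item_of false Q i j) (items false Q (i + 1) s))), (size s).+1.
  by split; [exact: Hins|split=> //; lia].
Qed.

Definition piece_ok (k : piece) : bool := ints M (enc_piece k).

Let piece_ints s : all piece_ok s -> ints M (enc_seq enc_piece s).
Proof. by move=> H; rewrite ints_seq //; apply: sub_all H. Qed.

Section Config.

Variables m Q : int.
Hypotheses (m0 : 0 <= m <= M) (Q0 : 0 <= Q <= M).

Let cfg := VPair (VInt m) (VInt Q).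

Lemma bump_ok x g : item_ok x -> segment_ok g -> eligible m Q x g ->
  0 <= bump_h Q (xs x) (gh g) (gl g) <= M /\
  0 <= bump_l Q (xs x) (gl g) <= M.
Proof.
rewrite /item_ok /segment_ok /eligible /bump_h /bump_l /fits /=.
move=> Hx Hg He; have : gl g + xs x <= Q \/ gh g + 2 <= m by move: He; clear; lia.
by case: ifP; move: Hx Hg m0 Q0; clear; lia.
Qed.

(** Only the segment in which the processing ends is split, so at most one segment is added; each
    segment receives at most one piece. *)
Lemma fill_ok x p s : item_ok x -> 0 <= p <= M -> all segment_ok s ->
  let r := fill m Q x p s in
  [/\ 0 <= r.1 <= M, all segment_ok r.2.1, all piece_ok r.2.2,
      (size r.2.1 <= (size s).+1)%N & (size r.2.2 <= size s)%N].
Proof.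
move=> Hx; elim: s p => [|g s IH] p pM; first by split.
move=> /= /andP[Hg Hs]; case: ifP => [_|p0]; first by split=> //=; rewrite Hg.
case: ifP => [He|_]; last first.
  by case: (fill _ _ x p s) (IH p pM Hs) => q [t k] /= [H1 H2 H3 H4 H5]; split=> //=; [rewrite Hg|lia].
have [Hh Hl] := bump_ok Hx Hg He.
set h := bump_h _ _ _ _ in Hh *; set l := bump_l _ _ _ in Hl *.
have [HgM gab g3 g4] := and4P Hg; move: HgM; rewrite /= => HgM.
have xiM : `|xi x| <= M by case/and3P: Hx => /= /andP[].
case: ifP => pl.
- have pM' : 0 <= p - (gb g - ga g + 1) <= M by move: pM p0 pl gab; clear; lia.
  case: (fill _ _ x _ s) (IH _ pM' Hs) => q [t k] /= [H1 H2 H3 H4 H5].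
  split=> //=; rewrite ?H2 ?H3 ?andbT /segment_ok /piece_ok /= ?xiM //;
    by move: Hh Hl HgM gab; clear; lia.
- split=> //=; rewrite ?Hs ?andbT /segment_ok /piece_ok /= ?xiM //;
    by move: Hh Hl HgM gab pl p0 pM g3 g4; clear; lia.
Qed.

(** The earlier pieces [acc] are threaded through the program and returned behind the new ones, so
    the table needs no concatenation function. *)
Lemma run_fill x p s acc : item_ok x -> 0 <= p <= M -> all segment_ok s ->
  all piece_ok acc -> (size s < L)%N -> (size s + size acc <= L)%N ->
  let r := fill m Q x p s in
  call f_fill
    (VPair cfg (VPair (enc_item x) (VPair (VInt p)
       (VPair (enc_seq enc_segment s) (enc_seq enc_piece acc)))))
    (VPair (VInt r.1) (VPair (enc_seq enc_segment r.2.1)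
       (enc_seq enc_piece (r.2.2 ++ acc)))) (size s).+1.
Proof.
move=> Hx + + Hacc.
have Harg p' s' : 0 <= p' <= M -> all segment_ok s' -> (size s' < L)%N ->
    (size s' + size acc <= L)%N ->
    (vsize (VPair cfg (VPair (enc_item x) (VPair (VInt p')
       (VPair (enc_seq enc_segment s') (enc_seq enc_piece acc))))) <= size_bound)%N.
  move=> pM Hs sL saL; apply: size_boundP; first by rewrite /= !leaves_enc; lia.
  rewrite (ints_pair _ cfg) (ints_pair _ (enc_item x)) (ints_pair _ (VInt p')).
  rewrite (ints_pair _ (enc_seq _ _)) segment_ints // piece_ints //.
  by case/and3P: Hx => -> _ _; move: m0 Q0 pM; rewrite /=; clear; lia.
have Hres p' s' : 0 <= p' <= M -> all segment_ok s' -> (size s' < L)%N ->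
    (size s' + size acc <= L)%N ->
    (vsize (let r := fill m Q x p' s' in VPair (VInt r.1) (VPair (enc_seq enc_segment r.2.1)
       (enc_seq enc_piece (r.2.2 ++ acc)))) <= size_bound)%N.
  move=> pM Hs sL saL; have [] := fill_ok Hx pM Hs.
  case: (fill _ _ _ _ _) => q [t k] /= H1 H2 H3 H4 H5.
  apply: size_boundP; first by rewrite /= !leaves_enc size_cat; lia.
  rewrite (ints_pair _ (VInt q)) (ints_pair _ (enc_seq _ _)) segment_ints // piece_ints ?all_cat ?H3 //.
  by move: H1; rewrite /=; clear; lia.
elim: s p => [|g s IH] p pM Hs sL saL r; (apply: (@callbI _ _ _ b_fill);
  [by []|exact: Harg|exact: Hres|]).
  by rewrite /b_fill /elen /enth /etl /=.
rewrite {}/r /b_fill /elen /enth /etl /=.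
case: (lerP p 0) => p0 /=; first by split.
have [Hg Hs'] := andP Hs; have [HgM gab g3 g4] := and4P Hg.
have sL' : (size s < L)%N by simpl in sL; lia.
have saL' : (size s + size acc <= L)%N by simpl in saL; lia.
rewrite /eligible.
case: (xr x <= ga g) => /=; last first.
  have := IH p pM Hs' sL' saL'; case: (fill _ _ _ _ s) => q [t k] /= H.
  exists (VPair (VInt q) (VPair (enc_seq enc_segment t) (enc_seq enc_piece (k ++ acc)))), (size s).+1.
  by split=> //; split=> //; lia.
case: (gb g <= xd x) => /=; last first.
  have := IH p pM Hs' sL' saL'; case: (fill _ _ _ _ s) => q [t k] /= H.
  exists (VPair (VInt q) (VPair (enc_seq enc_segment t) (enc_seq enc_piece (k ++ acc)))), (size s).+1.
  by split=> //; split=> //; lia.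
rewrite /bump_h /bump_l /fits.
case fitE: (gl g + xs x <= Q) => /=.
  case: (lerP (gb g - ga g + 1) p) => pl /=; last by rewrite ?fitE /=; split=> //; lia.
  have pM' : 0 <= p - (gb g - ga g + 1) <= M by move: pM p0 pl gab; clear; lia.
  have := IH _ pM' Hs' sL' saL'; case: (fill _ _ _ _ s) => q [t k] /= H.
  exists (VPair (VInt q) (VPair (enc_seq enc_segment t) (enc_seq enc_piece (k ++ acc)))), (size s).+1.
  by split=> //; rewrite ?fitE /= /=; split=> //; lia.
case: (gh g + 2 <= m) => /=; last first.
  have := IH p pM Hs' sL' saL'; case: (fill _ _ _ _ s) => q [t k] /= H.
  exists (VPair (VInt q) (VPair (enc_seq enc_segment t) (enc_seq enc_piece (k ++ acc)))), (size s).+1.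
  by split=> //; split=> //; lia.
case: (lerP (gb g - ga g + 1) p) => pl /=; last by rewrite ?fitE /=; split=> //; lia.
have pM' : 0 <= p - (gb g - ga g + 1) <= M by move: pM p0 pl gab; clear; lia.
have := IH _ pM' Hs' sL' saL'; case: (fill _ _ _ _ s) => q [t k] /= H.
exists (VPair (VInt q) (VPair (enc_seq enc_segment t) (enc_seq enc_piece (k ++ acc)))), (size s).+1.
by split=> //; rewrite ?fitE /= /=; split=> //; lia.
Qed.

Let chosen_ints s : all (fun i : int => `|i| <= M) s -> ints M (enc_seq VInt s).
Proof. by move=> H; rewrite ints_seq. Qed.

Definition state_ok (st : state) : bool :=
  [&& all segment_ok (segs st), all piece_ok (pieces st),
      all (fun i : int => `|i| <= M) (chosen st) & `|gain st| <= M].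

Lemma state_size st : state_ok st -> (size (segs st) <= L)%N ->
  (size (pieces st) <= L)%N -> (size (chosen st) <= L)%N ->
  ints M (enc_state st) /\ (leaves (enc_state st) <= 9 * L + 4)%N.
Proof.
case/and4P => H1 H2 H3 H4 s1 s2 s3; split; last by rewrite /= !leaves_enc; lia.
rewrite /enc_state !(ints_pair, segment_ints, piece_ints, chosen_ints) //.
Qed.

Lemma place_ok x st : item_ok x -> `|xd x + 1| <= M -> state_ok st ->
  `|gain st + xw x| <= M -> let s := cut (xd x + 1) (cut (xr x) (segs st)) in
  let st' := place m Q x st in
  [/\ state_ok st', (size (segs st') <= (size s).+1)%N,
     (size (pieces st') <= size (pieces st) + size s)%N &
     (size (chosen st') <= (size (chosen st)).+1)%N].
Proof.
move=> Hx dM Hst gM s st'; have [H1 H2 H3 H4] := and4P Hst.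
have pM : 0 <= xp x <= M by case/and3P: Hx => /=; clear; lia.
have rM : `|xr x| <= M by case/and3P: Hx => /=; clear; lia.
have Hs : all segment_ok s by apply: cut_ok => //; apply: cut_ok.
have sz : (size (segs st) <= size s)%N by apply: leq_trans (size_cut _ _); apply: size_cut.
rewrite /st' /place -/s; have [] := fill_ok Hx pM Hs.
case: (fill _ _ _ _ s) => q [t k] /= F1 F2 F3 F4 F5; case: ifP => _; last by split=> //; lia.
split=> //=; last by rewrite size_cat; lia.
rewrite /state_ok /= F2 all_cat F3 H2 H3 gM !andbT.
by case/and3P: Hx => /= /andP[].
Qed.

Lemma run_place x st : item_ok x -> `|xd x + 1| <= M -> state_ok st ->
  `|gain st + xw x| <= M -> let s := cut (xd x + 1) (cut (xr x) (segs st)) in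
  (size s + size (pieces st) < L)%N -> (size (chosen st) < L)%N ->
  call f_place (VPair cfg (VPair (enc_item x) (enc_state st)))
    (enc_state (place m Q x st)) (3 * L + 4).
Proof.
move=> Hx dM Hst gM s szL cL; have [H1 H2 H3 H4] := and4P Hst.
have pM : 0 <= xp x <= M by case/and3P: Hx => /=; clear; lia.
have rM : `|xr x| <= M by case/and3P: Hx => /=; clear; lia.
have Hs0 : all segment_ok (cut (xr x) (segs st)) by apply: cut_ok.
have Hs : all segment_ok s by apply: cut_ok.
have sz1 : (size (segs st) <= size (cut (xr x) (segs st)))%N by apply: size_cut.
have sz2 : (size (cut (xr x) (segs st)) <= size s)%N by apply: size_cut.
have [P1 P2 P3 P4] := place_ok Hx dM Hst gM; rewrite -/s in P2 P3.
have HxM : ints M (enc_item x) by case/and3P: Hx.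
apply: (@callbI _ _ _ b_place) => //.
- have [I1 I2] : ints M (enc_state st) /\ (leaves (enc_state st) <= 9 * L + 4)%N.
    by apply: state_size => //; lia.
  apply: size_boundP; first by rewrite [leaves _]/= -/(leaves (enc_state st)) /=; simpl in I2; lia.
  rewrite (ints_pair _ cfg) (ints_pair _ (enc_item x)) I1 HxM.
  by move: m0 Q0; rewrite /=; clear; lia.
- have [I1 I2] : ints M (enc_state (place m Q x st)) /\ (leaves (enc_state (place m Q x st)) <= 9 * L + 4)%N.
    by apply: state_size => //; lia.
  by apply: size_boundP => //; lia.
rewrite /b_place /elen /enth /etl /=.
exists (enc_seq enc_segment (cut (xr x) (segs st))), (size (segs st)).+1; split.
  by apply: run_cut => //; lia.
exists (enc_seq enc_segment s), (size (cut (xr x) (segs st))).+1; split.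
  by apply: run_cut => //; rewrite -/s; lia.
have Hf := @run_fill x (xp x) s (pieces st) Hx pM Hs H2 _ _.
rewrite /place -/s.
case: (fill _ _ x _ s) Hf => q [t k] /= Hf.
exists (VPair (VInt q) (VPair (enc_seq enc_segment t) (enc_seq enc_piece (k ++ pieces st)))), (size s).+1.
split; first by apply: Hf; lia.
by case: (q <= 0) => /=; split=> //; lia.
Qed.

End Config.

End Execution.

#[local] Arguments vsize : simpl nomatch.

(** * Segments *)

(** A tiling in increasing order; the end [hi] is exclusive. *)
Fixpoint chain (lo : int) (s : seq segment) (hi : int) : bool :=
  if s is g :: s' then [&& ga g == lo, lo <= gb g & chain (gb g + 1) s' hi]
  else lo == hi.

Lemma chain_le lo s hi : chain lo s hi -> lo <= hi.
Proof. by elim: s lo => [|g s IH] lo /=; [|case/and3P=> _ ? /IH]; lia. Qed.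

Lemma cut_id lo s hi c : chain lo s hi -> c <= lo -> cut c s = s.
Proof.
elim: s lo => [|g s IH] lo //= /and3P[/eqP gE lo_gb Hs] clo.
by rewrite (IH _ Hs) ?ifF //; lia.
Qed.

Lemma chain_cut lo s hi c : chain lo s hi -> chain lo (cut c s) hi.
Proof.
elim: s lo => [|g s IH] lo //= /and3P[/eqP gE lo_gb /IH Hs].
by case: ifP => [/andP[? ?]|_] /=; rewrite ?subrK Hs ?gE ?eqxx /= ?andbT ?lo_gb //; lia.
Qed.

(** At most one segment of a tiling contains both [c - 1] and [c]. *)
Lemma size_cut_chain lo s hi c : chain lo s hi -> (size (cut c s) <= (size s).+1)%N.
Proof.
elim: s lo => [|g s IH] lo //= /and3P[/eqP gE lo_gb Hs].
case: ifP => [/andP[? ?]|_] /=; last by have := IH _ Hs; lia.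
by rewrite (cut_id Hs) //; lia.
Qed.

Lemma chain_fill m Q x p lo s hi :
  chain lo s hi -> chain lo (fill m Q x p s).2.1 hi.
Proof.
elim: s lo p => [|g s IH] lo p //= /and3P[/eqP gE lo_gb Hs].
case: ifP => [_|p0] /=; first by rewrite gE eqxx lo_gb.
case: ifP => _; last first.
  by case: (fill _ _ _ p _) (IH _ p Hs) => q [t k] /= ->; rewrite gE eqxx lo_gb.
case: ifP => pl.
  by case: (fill _ _ _ _ _) (IH _ (p - (gb g - ga g + 1)) Hs) => q [t k] /= ->; rewrite gE eqxx lo_gb.
by rewrite /= Hs gE eqxx andbT /=; lia.
Qed.

(** * Size invariants and execution of the recursion *)

Section Solve.

Variables (K M : int) (L : nat) (m Q : int).
Hypotheses (M1 : 1 <= M) (m0 : 0 <= m <= M) (Q0 : 0 <= Q <= M).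

Notation call := (callb (prog K) (size_bound M L)).
Notation solve_rec := (solve_rec m Q K).
Notation reweights := (reweights m Q K).

(* Every integer met by [solve_rec n s] is at most [M]. *)
Fixpoint traced (n : nat) (s : seq item) : Prop :=
  match n, s with
  | n'.+1, x :: s' =>
      all (item_ok M) s /\
      if xf x <= 0 then traced n' s'
      else [/\ `|K * xf x| <= M, `|m * Q * xlen x| <= M & traced n' (reweights x s')]
  | _, _ => True
  end.

Lemma traced_ok n s : size s = n -> traced n s -> all (item_ok M) s.
Proof. by case: n s => [|n] [|x s] //= _ []. Qed.

Definition gains (s : seq item) : int := \sum_(x <- s) `|xw x|.

Lemma gains_cons x s : gains (x :: s) = `|xw x| + gains s.
Proof. exact: big_cons. Qed.

Lemma gains_ge0 s : 0 <= gains s.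
Proof. exact: sumr_ge0. Qed.

Lemma gains_reweights x s : gains (reweights x s) = gains s.
Proof. by rewrite /gains big_map. Qed.

Lemma size_reweights x s : size (reweights x s) = size s.
Proof. exact: size_map. Qed.

Lemma all_reweights x s (a : item -> bool) :
  (forall y z, xi y = xi z -> xr y = xr z -> xd y = xd z -> xp y = xp z ->
     xs y = xs z -> xw y = xw z -> a y = a z) ->
  all a (reweights x s) = all a s.
Proof. by move=> Ha; rewrite all_map; apply: eq_all => y /=; apply: Ha. Qed.

(** The count [3 * n + 1] consists of the initial segment and, for each job, two cuts and one split
    by [fill]. After its two cuts the next job meets at most [3 * n + 3] segments, whence the bound
    on the pieces. *)
Lemma solve_state_ok n s : size s = n -> traced n s ->
  all (fun x => `|xd x + 1| <= M) s -> gains s <= M ->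
  let st := solve_rec n s in
  [/\ chain (- Q) (segs st) (Q + 1), state_ok M st &
    [/\ `|gain st| <= gains s, (size (segs st) <= 3 * n + 1)%N,
      (size (pieces st) <= n * (3 * n + 3))%N & (size (chosen st) <= n)%N]].
Proof.
elim: n s => [|n IH] [|x s] //= sz.
  move=> _ _ _; split; [|by rewrite /state_ok /segment_ok /= normr0; lia|by rewrite normr0 /gains big_nil].
  by rewrite eqxx /=; lia.
case: sz => sz [/andP[Hx Hs]]; rewrite gains_cons => T /andP[dM Hd] gM.
have gs := gains_ge0 s.
case: ifP T => [_ T|_ [_ _ T]].
  have gM' : gains s <= M by lia.
  have [H1 H2 [H3 H4 H5 H6]] := IH s sz T Hd gM'; split=> //; split; try lia.
have szr : size (reweights x s) = n by rewrite size_reweights.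
have Hdr : all (fun x => `|xd x + 1| <= M) (reweights x s).
  by rewrite all_reweights // => y z _ _ ->.
have gM' : gains (reweights x s) <= M by rewrite gains_reweights; lia.
have [H1 H2 [H3 H4 H5 H6]] := IH _ szr T Hdr gM'.
set st := solve_rec n _ in H1 H2 H3 H4 H5 H6 *.
rewrite gains_reweights in H3.
have gM2 : `|gain st + xw x| <= M by lia.
have [P1 P2 P3 P4] := place_ok M1 m0 Q0 Hx dM H2 gM2.
have C1 := chain_cut (xr x) H1.
have s1 := size_cut_chain (xr x) H1; have s2 := size_cut_chain (xd x + 1) C1.
split=> //.
- rewrite /place; have := chain_fill m Q x (xp x) (chain_cut (xd x + 1) C1).
  by case: (fill _ _ _ _ _) => q [t k] /=; case: ifP.
- split; last by lia.
  + rewrite /place; case: (fill _ _ _ _ _) => q [t k]; case: ifP => _ /=; lia.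
  + by lia.
  + apply: leq_trans P3 _; clear -s1 s2 H4 H5.
    have : (n * (3 * n + 3) + (3 * n + 3) <= n.+1 * (3 * n.+1 + 3))%N by nia.
    by lia.
Qed.

(** The lower bound on [L] makes room for segments and pieces together. A level pays for one
    reweighting, two cuts and one filling, which fit into [4 * L + 6] calls. *)
Lemma run_solve n s : size s = n -> traced n s ->
  all (fun x => `|xd x + 1| <= M) s -> gains s <= M ->
  ((n + 2) * (3 * n + 5) <= L)%N ->
  call f_solve (VPair (VPair (VInt m) (VInt Q)) (enc_seq enc_item s))
    (enc_state (solve_rec n s)) ((n + 1) * (4 * L + 6)).
Proof.
have HcM : ints M (VPair (VInt m) (VInt Q)) by move: m0 Q0; rewrite /=; clear; lia.
have Hres n' s' : size s' = n' -> traced n' s' ->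
    all (fun x => `|xd x + 1| <= M) s' -> gains s' <= M ->
    ((n' + 2) * (3 * n' + 5) <= L)%N ->
    (vsize (enc_state (solve_rec n' s')) <= size_bound M L)%N.
  move=> sz T Hd gM HL; have [H1 H2 [H3 H4 H5 H6]] := solve_state_ok sz T Hd gM.
  have HL1 : (3 * n' + 1 <= L)%N by apply: leq_trans HL; clear; nia.
  have HL2 : (n' * (3 * n' + 3) <= L)%N by apply: leq_trans HL; clear; nia.
  have [I1 I2] : ints M (enc_state (solve_rec n' s')) /\
      (leaves (enc_state (solve_rec n' s')) <= 9 * L + 4)%N.
    by apply: (state_size M1 m0 Q0) => //; clear -HL1 HL2 H4 H5 H6; lia.
  by apply: size_boundP => //; lia.
elim: n s => [|n IH] [|x s] // sz T Hd gM HL; (apply: (@callbI _ _ _ (b_solve K)); [by []| |exact: Hres|]).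
- apply: size_boundP; first by rewrite /=; lia.
  by rewrite ints_pair HcM /= normr0; lia.
- by rewrite /b_solve /elen /enth /etl /=; split; [rewrite sub0r|lia].
- apply: size_boundP; first by rewrite /= leaves_enc; case: sz => ->; clear -HL; nia.
  rewrite ints_pair HcM ints_seq; last by lia.
  by case: T => H _; apply: sub_all H => y /and3P[].
case: sz => sz; have HL' : ((n + 2) * (3 * n + 5) <= L)%N by apply: leq_trans HL; clear; nia.
move: T => /= -[/andP[Hx Hs]]; move: Hd gM; rewrite gains_cons => /andP[dM Hd] gM T.
have gs := gains_ge0 s.
rewrite /b_solve /elen /enth /etl /=.
case: (xf x <= 0) T => [T|[fM DM T]] /=.
  exists (enc_state (solve_rec n s)), ((n + 1) * (4 * L + 6))%N; split.
    by apply: IH => //; lia.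
  by split=> //; rewrite addSn mulSn; lia.
have szr : size (reweights x s) = n by rewrite size_reweights.
have Hdr : all (fun x => `|xd x + 1| <= M) (reweights x s).
  by rewrite all_reweights // => y z _ _ ->.
have gM' : gains (reweights x s) <= M by rewrite gains_reweights; lia.
have [H1 H2 [H3 H4 H5 H6]] := solve_state_ok szr T Hdr gM'.
rewrite gains_reweights in H3.
have C1 := chain_cut (xr x) H1.
have s1 := size_cut_chain (xr x) H1; have s2 := size_cut_chain (xd x + 1) C1.
exists (enc_seq enc_item (reweights x s)), (size s).+1; split.
  apply: run_reweight => //.
  - by case/and3P: Hx => /= ? _ _; rewrite fM DM /=; lia.
  - exact: traced_ok szr T.
  - by rewrite sz; clear -HL; nia.
exists (enc_state (solve_rec n (reweights x s))), ((n + 1) * (4 * L + 6))%N; split.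
  exact: IH.
exists (enc_state (place m Q x (solve_rec n (reweights x s)))), (3 * L + 4)%N; split.
  by apply: run_place => //; lia.
split=> //; have : (n.+2 <= L)%N by clear -HL; nia.
by rewrite addSn mulSn sz; lia.
Qed.

End Solve.

(** * Schedules produced by the algorithm *)

Section Fill.

Variables m Q : int.

Definition bumped (x : item) (g : segment) (a b : int) : segment :=
  Segment a b (bump_h Q (xs x) (gh g) (gl g)) (bump_l Q (xs x) (gl g)).

Definition new_piece (x : item) (g : segment) (a b : int) : piece :=
  Piece (xi x) (bump_h Q (xs x) (gh g) (gl g)) a b (xs x).

(** The graph of [fill], so that inductions follow its cases instead of nested tests. In [FillDone]
    the time left is exactly 0, because a segment is never filled beyond the remaining time. *)
Inductive fill_spec (x : item) :
    int -> seq segment -> int -> seq segment -> seq piece -> Prop :=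
| FillNil p : 0 <= p -> fill_spec x p [::] p [::] [::]
| FillDone s : fill_spec x 0 s 0 s [::]
| FillSkip p g s q t k : 0 < p -> ~~ eligible m Q x g ->
    fill_spec x p s q t k -> fill_spec x p (g :: s) q (g :: t) k
| FillWhole p g s q t k : 0 < p -> eligible m Q x g -> gb g - ga g + 1 <= p ->
    fill_spec x (p - (gb g - ga g + 1)) s q t k ->
    fill_spec x p (g :: s) q (bumped x g (ga g) (gb g) :: t)
      (new_piece x g (ga g) (gb g) :: k)
| FillPart p g s : 0 < p -> eligible m Q x g -> p < gb g - ga g + 1 ->
    fill_spec x p (g :: s) 0
      (bumped x g (ga g) (ga g + p - 1) ::
       Segment (ga g + p) (gb g) (gh g) (gl g) :: s)
      [:: new_piece x g (ga g) (ga g + p - 1)].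

Lemma fillP x p s : 0 <= p ->
  let r := fill m Q x p s in fill_spec x p s r.1 r.2.1 r.2.2.
Proof.
elim: s p => [|g s IH] p p0 /=; first exact: FillNil.
case: lerP => p1 /=.
  by have -> : p = 0 by [lia]; apply: FillDone.
case: ifP => [E|/negbT E]; last first.
  by move: (IH _ p0); case: (fill _ _ _ _ _) => q [t k] /=; apply: FillSkip.
case: lerP => pl; last exact: FillPart.
have p2 : 0 <= p - (gb g - ga g + 1) by lia.
by move: (IH _ p2); case: (fill _ _ _ _ _) => q [t k] /=; apply: FillWhole.
Qed.

Definition piece_len (k : piece) : int := kb k - ka k + 1.

Lemma fill_work x p s q t k : fill_spec x p s q t k ->
  0 <= q /\ \sum_(u <- k) piece_len u = p - q.
Proof.
elim=> {p s q t k}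
  [p p0|s|p g s q t k _ _ _ //|p g s q t k _ _ _ _ [q0 IH]|p g s p0 _ _].
- by rewrite big_nil subrr.
- by rewrite big_nil.
- by split=> //; rewrite big_cons IH /piece_len /=; lia.
- by split=> //; rewrite big_seq1 /piece_len /=; lia.
Qed.

Definition covers (k : piece) (t : int) : bool := ka k <= t <= kb k.

(* [nar] tells whether all demands are at most half a host or all are equal to
   a whole host. *)
Definition item_class (nar : bool) (x : item) : Prop :=
  [/\ 0 < xs x, xs x <= Q & if nar then (xs x + xs x <= Q : Prop) else xs x = Q].

Definition segment_class (nar : bool) (g : segment) : Prop :=
  [/\ 0 <= gh g < m, 0 <= gl g <= Q & if nar then True else gl g = 0 \/ gl g = Q].

(** A narrow item of size at most [Q / 2] fails to fit only if the load exceeds [Q - xs x], hence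
    [Q / 2]. A wide item fits on an empty host, so the current host must be full. *)
Lemma full_half nar x g : item_class nar x -> segment_class nar g ->
  fits Q (xs x) (gl g) = false -> Q <= gl g + gl g.
Proof.
by rewrite /fits; move=> [x0 xQ xc] [g0 gQ gc]; case: nar xc gc => xc gc; lia.
Qed.

Lemma bumped_class nar x g a b : item_class nar x -> segment_class nar g ->
  eligible m Q x g -> segment_class nar (bumped x g a b).
Proof.
rewrite /eligible /bumped /segment_class /bump_h /bump_l /fits /=.
move=> [x0 xQ xc] [g0 gQ gc]; case: nar xc gc => xc gc; case: ifP; split; lia.
Qed.

Lemma fill_class nar x p s q t k : item_class nar x -> fill_spec x p s q t k ->
  {in s, forall g, segment_class nar g} -> {in t, forall g, segment_class nar g}.
Proof.
move=> Hx; elim=> {p s q t k}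
  [p p0|s|p g s q t k _ _ _ IH|p g s q t k _ Ex _ _ IH|p g s p0 Ex _] // Hs.
- move=> u; rewrite inE => /predU1P[->|]; first by apply: Hs; rewrite mem_head.
  by apply: IH => v vs; apply: Hs; rewrite inE vs orbT.
- have Hg := Hs g (mem_head _ _); move=> u; rewrite inE => /predU1P[->|].
    exact: bumped_class Ex.
  by apply: IH => v vs; apply: Hs; rewrite inE vs orbT.
- have Hg := Hs g (mem_head _ _); move=> u; rewrite !inE => /or3P[/eqP->|/eqP->|us].
  + exact: bumped_class Ex.
  + by [].
  + by apply: Hs; rewrite inE us orbT.
Qed.

Lemma fill_pieces nar x p s q t k lo hi : item_class nar x ->
  fill_spec x p s q t k -> chain lo s hi ->
  {in s, forall g, segment_class nar g} ->
  {in k, forall u, [/\ kj u = xi x, kc u = xs x, 0 <= kh u < m, lo <= ka u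
      & xr x <= ka u /\ ka u <= kb u <= xd x]}.
Proof.
move=> Hx H; elim: H lo => {p s q t k}
  [p p0|s|p g s q t k _ _ _ IH|p g s q t k _ Ex _ _ IH|p g s p0 Ex pl] // lo.
- move=> /= /and3P[/eqP gE lo_gb Hc] Hs u uk.
  have [|H1 H2 H3 H4 [H5 H6]] := IH _ Hc _ u uk; last by split=> //; lia.
  by move=> v vs; apply: Hs; rewrite inE vs orbT.
- move=> /= /and3P[/eqP gE lo_gb Hc] Hs u; rewrite inE => /predU1P[->|uk]; last first.
    have [|H1 H2 H3 H4 [H5 H6]] := IH _ Hc _ u uk; last by split=> //; lia.
    by move=> v vs; apply: Hs; rewrite inE vs orbT.
  have [Hh _ _] := bumped_class 0 0 Hx (Hs g (mem_head _ _)) Ex.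
  by move: Ex; rewrite /eligible /=; split=> //; lia.
- move=> /= /and3P[/eqP gE lo_gb Hc] Hs u; rewrite inE => /eqP->.
  have [Hh _ _] := bumped_class 0 0 Hx (Hs g (mem_head _ _)) Ex.
  by move: Ex; rewrite /eligible /=; split=> //; lia.
Qed.

Definition load (B : seq piece) (h t : int) : int :=
  \sum_(u <- B | (kh u == h) && covers u t) kc u.

Definition loaded (f : int -> int -> int) (g : segment) : Prop :=
  forall t, ga g <= t <= gb g ->
    [/\ (forall h, f h t <= Q), (forall h, gh g < h -> f h t = 0) & f (gh g) t <= gl g].

Lemma load_cons u B h t : load (u :: B) h t =
  (if (kh u == h) && covers u t then kc u else 0) + load B h t.
Proof. by rewrite /load big_cons; case: ifP => _; rewrite ?add0r. Qed.

Lemma load_eq0 B h t : {in B, forall u, ~~ covers u t} -> load B h t = 0.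
Proof.
move=> H; rewrite /load big1_seq // => u /andP[/andP[_ c] uB].
by have := H u uB; rewrite c.
Qed.

Lemma loaded_sub f g g' : ga g <= ga g' -> gb g' <= gb g -> gh g' = gh g ->
  gl g' = gl g -> loaded f g -> loaded f g'.
Proof. by move=> H1 H2 H3 H4 H t Ht; rewrite H3 H4; apply: H; lia. Qed.

Lemma loaded_ext f f' g : (forall h t, ga g <= t <= gb g -> f' h t = f h t) ->
  loaded f g -> loaded f' g.
Proof.
move=> E H t Ht; have [H1 H2 H3] := H t Ht.
by split=> [h|h hh|]; rewrite E //; apply: H2.
Qed.

Lemma loaded_bumped nar f f' x g a b : item_class nar x -> segment_class nar g ->
  ga g <= a -> b <= gb g ->
  (forall h t, a <= t <= b -> f' h t = f h t +
     (if bump_h Q (xs x) (gh g) (gl g) == h then xs x else 0)) ->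
  loaded f g -> loaded f' (bumped x g a b).
Proof.
move=> [x0 xQ _] [_ gQ _] ga_a b_gb E H t /= Ht.
have [|H1 H2 H3] := H t; first by lia.
have {}E h := E h t Ht.
rewrite /bump_l; move: E; rewrite /bump_h /fits; case: ifP => F E; split=> [h|h hh|]; rewrite E.
- by case: eqP => [<-|_]; rewrite ?addr0 //; lia.
- by rewrite H2 // ifF //; lia.
- by rewrite eqxx; lia.
- by case: eqP => [<-|_]; rewrite ?addr0 // H2; lia.
- by rewrite H2 ?ifF //; lia.
- by rewrite eqxx H2; lia.
Qed.

Lemma chain_mem lo s hi g : chain lo s hi -> g \in s ->
  [/\ lo <= ga g, ga g <= gb g & gb g < hi].
Proof.
elim: s lo => [|g' s IH] lo //= /and3P[/eqP gE lo_gb Hc].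
rewrite inE => /predU1P[->|/IH-/(_ _ Hc)[H1 H2 H3]]; last by split; lia.
by have := chain_le Hc; split; lia.
Qed.

Lemma fill_chain x p s q t k lo hi : fill_spec x p s q t k ->
  chain lo s hi -> chain lo t hi.
Proof.
move=> H; elim: H lo => {p s q t k}
  [p p0|s|p g s q t k _ _ _ IH|p g s q t k _ _ _ _ IH|p g s p0 Ex pl] lo //=.
- by case/and3P=> -> -> /IH ->.
- by case/and3P=> -> -> /IH ->.
- by case/and3P=> /eqP gE lo_gb Hc; rewrite subrK Hc gE !eqxx; lia.
Qed.

(** A new piece covers exactly one segment of the result, the one bumped along with it; every other
    segment keeps its loads. *)
Lemma fill_loaded nar x p s q t k lo hi f : item_class nar x ->
  fill_spec x p s q t k -> chain lo s hi ->
  {in s, forall g, segment_class nar g} -> {in s, forall g, loaded f g} ->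
  {in t, forall g, loaded (fun h i => f h i + load k h i) g}.
Proof.
move=> Hx H; elim: H lo => {p s q t k}
  [p p0|s|p g s q t k _ _ F IH|p g s q t k _ Ex _ F IH|p g s p0 Ex pl] // lo.
- by move=> _ _ Hl g gs; apply: loaded_ext (Hl g gs) => h i _; rewrite /load big_nil addr0.
- move=> /= /and3P[/eqP gE lo_gb Hc] Hs Hl.
  have Hs' : {in s, forall g, segment_class nar g} by move=> v vs; apply: Hs; rewrite inE vs orbT.
  have Hl' : {in s, forall g, loaded f g} by move=> v vs; apply: Hl; rewrite inE vs orbT.
  move=> u; rewrite inE => /predU1P[->|]; last exact: IH Hc Hs' Hl' u.
  apply: loaded_ext (Hl g (mem_head _ _)) => h i Hi; rewrite load_eq0 ?addr0 // => v vk.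
  by have [] := fill_pieces Hx F Hc Hs' vk; rewrite /covers; lia.
- move=> /= /and3P[/eqP gE lo_gb Hc] Hs Hl.
  have Hs' : {in s, forall g, segment_class nar g} by move=> v vs; apply: Hs; rewrite inE vs orbT.
  have Hl' : {in s, forall g, loaded f g} by move=> v vs; apply: Hl; rewrite inE vs orbT.
  have Hg := Hs g (mem_head _ _); have Lg := Hl g (mem_head _ _).
  move=> u; rewrite inE => /predU1P[->|ut].
    apply: (loaded_bumped Hx Hg) Lg => // h i Hi.
    rewrite load_cons /= {1}/covers /= Hi andbT [load k h i]load_eq0 ?addr0 // => v vk.
    by have [] := fill_pieces Hx F Hc Hs' vk; rewrite /covers; lia.
  apply: loaded_ext (IH _ Hc Hs' Hl' u ut) => h i Hi; rewrite load_cons /=.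
  rewrite ifF ?add0r // /covers /=.
  by have [] := chain_mem (fill_chain F Hc) ut; lia.
- move=> /= /and3P[/eqP gE lo_gb Hc] Hs Hl.
  have Hg := Hs g (mem_head _ _); have Lg := Hl g (mem_head _ _).
  have E h i : load [:: new_piece x g (ga g) (ga g + p - 1)] h i =
    if (bump_h Q (xs x) (gh g) (gl g) == h) && (ga g <= i <= ga g + p - 1) then xs x else 0.
    by rewrite load_cons /load big_nil addr0.
  move=> u; rewrite !inE => /or3P[/eqP->|/eqP->|us].
  + by apply: (loaded_bumped Hx Hg) Lg => // [|h i Hi]; [lia|rewrite E Hi andbT].
  + apply: (@loaded_ext f) => [h i /= Hi|]; last by apply: (loaded_sub _ _ _ _ Lg) => //=; lia.
    by rewrite E ifF ?addr0 //; lia.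
  + have us' : u \in g :: s by rewrite inE us orbT.
    apply: loaded_ext (Hl u us') => h i Hi; have [H1 H2 H3] := chain_mem Hc us.
    by rewrite E ifF ?addr0 //; lia.
Qed.

(** New pieces lie in different segments of a tiling. From this derive both the uniqueness of the
    host of a job in a slot and the distinctness of the slots in which it runs. *)
Lemma fill_once nar x p s q t k lo hi i : item_class nar x ->
  fill_spec x p s q t k -> chain lo s hi ->
  {in s, forall g, segment_class nar g} ->
  (count (covers^~ i) k <= 1)%N.
Proof.
move=> Hx H; elim: H lo => {p s q t k}
  [p p0|s|p g s q t k _ _ _ IH|p g s q t k _ Ex _ F IH|p g s p0 Ex pl] // lo /=;
  try by case: (covers _ _).
- by move=> /and3P[_ _ Hc] Hs; apply: IH Hc _ => v vs; apply: Hs; rewrite inE vs orbT.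
- move=> /and3P[/eqP gE lo_gb Hc] Hs.
  have Hs' : {in s, forall g, segment_class nar g} by move=> v vs; apply: Hs; rewrite inE vs orbT.
  case E: (covers _ i); last exact: IH Hc Hs'.
  rewrite (_ : count _ k = 0%N) //; apply/eqP; rewrite -leqn0 leqNgt -has_count.
  apply/hasPn => u uk; have [] := fill_pieces Hx F Hc Hs' uk.
  by move: E; rewrite /covers /=; lia.
Qed.

Definition overlap (a b r d : int) : int := Num.max 0 (Num.min b d - Num.max a r + 1).

(* Twice the load bound of the schedule on the window [r..d]: by next fit, each
   closed host has load at least Q / 2. *)
Definition potential (s : seq segment) (r d : int) : int :=
  \sum_(g <- s) overlap (ga g) (gb g) r d * (gh g * Q + (gl g + gl g)).

Definition extent (s : seq segment) (r d : int) : int :=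
  \sum_(g <- s) overlap (ga g) (gb g) r d.

Lemma overlap_ge0 a b r d : 0 <= overlap a b r d.
Proof. by rewrite /overlap; lia. Qed.

Lemma overlapD a c b r d : a <= c -> c <= b + 1 ->
  overlap a b r d = overlap a (c - 1) r d + overlap c b r d.
Proof. by rewrite /overlap; lia. Qed.

Lemma potential_cut c s r d : potential (cut c s) r d = potential s r d.
Proof.
elim: s => //= g s IH; rewrite /potential in IH *; case: ifP => [/andP[c1 c2]|_]; rewrite !big_cons IH //=.
by rewrite addrA -mulrDl -overlapD //; lia.
Qed.

Lemma extent_chain lo s hi r d : chain lo s hi -> r <= d + 1 -> lo <= r -> d < hi ->
  extent s r d = d - r + 1.
Proof.
(* Generalised to any left end [lo], since in the induction the tail may start inside or beyond the
   window. *)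
move=> Hc rd lor dhi; suff: extent s r d = Num.max 0 (d - Num.max r lo + 1) by lia.
elim: s lo Hc {lor} => [|g s IH] lo /=.
  by move=> /eqP lohi; rewrite /extent big_nil; lia.
move=> /and3P[/eqP gE lo_gb Hc]; rewrite /extent big_cons -/(extent s r d) (IH _ Hc) gE.
by have := chain_le Hc; rewrite /overlap; lia.
Qed.

(** If the item does not fit, closing the host replaces [gl g + gl g] by [Q], which is no increase
    by [full_half]. In both cases the item itself adds twice its size. *)
Lemma bump_potential nar x g : item_class nar x -> segment_class nar g ->
  let h := bump_h Q (xs x) (gh g) (gl g) in let l := bump_l Q (xs x) (gl g) in
  h * Q + (l + l) <= gh g * Q + (gl g + gl g) + (xs x + xs x).
Proof.
move=> Hx Hg; have := full_half Hx Hg; rewrite /bump_h /bump_l /fits.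
by case: ifP => [_ _|_ /(_ erefl)]; rewrite ?mulrDl; lia.
Qed.

Lemma fill_potential nar x p s q t k r d : item_class nar x ->
  fill_spec x p s q t k -> {in s, forall g, segment_class nar g} ->
  potential t r d <= potential s r d +
    (xs x + xs x) * \sum_(u <- k) overlap (ka u) (kb u) r d.
Proof.
rewrite /potential.
move=> Hx; elim=> {p s q t k}
  [p p0|s|p g s q t k _ _ _ IH|p g s q t k _ Ex _ F IH|p g s p0 Ex pl] Hs.
- by rewrite !big_nil mulr0.
- by rewrite big_nil mulr0 addr0.
- rewrite !big_cons -addrA lerD2l; apply: IH => v vs; apply: Hs; rewrite inE vs orbT //.
- have Hs' : {in s, forall g, segment_class nar g} by move=> v vs; apply: Hs; rewrite inE vs orbT.
  rewrite !big_cons /=; have := bump_potential Hx (Hs g (mem_head _ _)).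
  have := overlap_ge0 (ga g) (gb g) r d; move: (overlap _ _ _ _) => o o0 /= /(ler_wpM2l o0).
  have := IH Hs'; set A := \sum_(_ <- t) _; set B := \sum_(_ <- s) _; set C := \sum_(_ <- k) _.
  by move: A B C => A B C; rewrite !mulrDr mulrDl; lia.
- rewrite !big_cons big_nil /=; have := bump_potential Hx (Hs g (mem_head _ _)).
  rewrite (@overlapD (ga g) (ga g + p) (gb g)); [|lia|lia].
  have := overlap_ge0 (ga g) (ga g + p - 1) r d.
  move: (overlap _ (ga g + p - 1) _ _) => o o0 /= /(ler_wpM2l o0).
  move: (overlap (ga g + p) _ _ _) => o'; set B := \sum_(_ <- s) _; move: B => B.
  by rewrite addr0 !mulrDr !mulrDl; lia.
Qed.

Definition aligned (c : int) (g : segment) : bool := (gb g < c) || (c <= ga g).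

Lemma aligned_cut c s : all (aligned c) (cut c s).
Proof.
elim: s => //= g s IH; case: ifP => [/andP[? ?]|] /=; rewrite IH /aligned /=; lia.
Qed.

Lemma aligned_cut2 c c' s : all (aligned c) s -> all (aligned c) (cut c' s).
Proof.
elim: s => //= g s IH /andP[Hg /IH Hs]; case: ifP => [/andP[? ?]|] /=; rewrite Hs.
  by move: Hg; rewrite /aligned /=; lia.
by rewrite Hg.
Qed.

(** If time is left, every segment inside the window was filled or ineligible. The filled slots
    number at most [p]; an ineligible segment inside the window can only fail for lack of capacity,
    and then has potential at least [m * Q] per slot. *)
Lemma fill_failure nar x p s q t k : item_class nar x -> 0 <= m ->
  fill_spec x p s q t k -> 0 < q -> {in s, forall g, segment_class nar g} ->
  all (fun g => ga g <= gb g) s -> all (aligned (xr x)) s -> all (aligned (xd x + 1)) s ->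
  m * Q * (extent s (xr x) (xd x) - p) <= potential s (xr x) (xd x).
Proof.
rewrite /potential /extent.
move=> Hx m0 H q0; elim: H q0 => {p s q t k}
  [p p0 q0|//|p g s q t k p0 Ex _ IH q0|p g s q t k _ Ex _ _ IH q0|//] Hs.
- move=> _ _ _; rewrite !big_nil; case: Hx => s0 sQ _.
  by rewrite sub0r mulrN oppr_le0 mulr_ge0 ?mulr_ge0 //; lia.
- have Hs' : {in s, forall g, segment_class nar g} by move=> v vs; apply: Hs; rewrite inE vs orbT.
  move=> /= /andP[A0 B0] /andP[A1 B1] /andP[A2 B2]; rewrite !big_cons.
  have := IH q0 Hs' B0 B1 B2; have := overlap_ge0 (ga g) (gb g) (xr x) (xd x).
  have Hg := Hs g (mem_head _ _).
  (* Alignment at both ends excludes segments that straddle the border of the window. *)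
  have [E|E] : overlap (ga g) (gb g) (xr x) (xd x) = 0 \/ (xr x <= ga g) && (gb g <= xd x).
  + by move: A1 A2; rewrite /aligned /overlap; lia.
  + by rewrite E mul0r !add0r.
  have := full_half Hx Hg; move: Ex; rewrite /eligible andbA E /= negb_or -eqbF_neg.
  move=> /andP[/eqP F Fm] /(_ F) half.
  (* At least [m - 1] hosts are closed, each counting [Q], and twice the load of the current host is
     at least [Q]. *)
  have V : m * Q <= gh g * Q + (gl g + gl g).
    have : (m - 1) * Q <= gh g * Q by case: Hx => ? ? _; apply: ler_wpM2r; lia.
    by rewrite mulrBl mul1r; lia.
  move: (overlap _ _ _ _) => o o0 /=; have := ler_wpM2l o0 V.
  by rewrite -addrA [m * Q * (o + _)]mulrDr [o * (m * Q)]mulrC; lia.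
- have Hs' : {in s, forall g, segment_class nar g} by move=> v vs; apply: Hs; rewrite inE vs orbT.
  move=> /= /andP[A0 B0] /andP[A1 B1] /andP[A2 B2]; rewrite !big_cons.
  have := IH q0 Hs' B0 B1 B2; have [gh0 gl0 _] := Hs g (mem_head _ _).
  have E : overlap (ga g) (gb g) (xr x) (xd x) <= gb g - ga g + 1.
    by rewrite /overlap; lia.
  have [s0 sQ _] := Hx.
  have mQ0 : 0 <= m * Q by apply: mulr_ge0; lia.
  have V0 : 0 <= overlap (ga g) (gb g) (xr x) (xd x) * (gh g * Q + (gl g + gl g)).
    apply: mulr_ge0; first exact: overlap_ge0.
    have : 0 <= gh g * Q by apply: mulr_ge0; lia.
    by lia.
  have := ler_wpM2l mQ0 E.
  set A := \sum_(_ <- _) _; set B := \sum_(_ <- _) _; move: A B (m * Q) (_ * (_ * _ + _)) V0 => A B c v v0.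
  by rewrite !mulrDr !mulrN !mulrDr; lia.
Qed.

End Fill.

Definition work (B : seq piece) (j : int) : int :=
  \sum_(u <- B | kj u == j) piece_len u.

Definition runs_at (j i : int) (u : piece) : bool := (kj u == j) && covers u i.

Definition area (P : item -> bool) (s : seq item) : int :=
  \sum_(x <- s | P x) xs x * xp x.

(** The potential of a window is charged to all jobs meeting it, as a piece may lie anywhere in the
    window of its job; [nested_after] later reduces these jobs to the ones within. *)
Definition meets (r d : int) (x : item) : bool := (xr x <= d) && (r <= xd x).

Record state_spec (m Q : int) (nar : bool) (s : seq item) (st : state) : Prop :=
  StateSpec {
    spec_chain : chain (- Q) (segs st) (Q + 1);
    spec_class : {in segs st, forall g, segment_class m Q nar g};
    spec_load : {in segs st, forall g, loaded Q (load (pieces st)) g};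
    spec_chosen : {subset chosen st <= map xi s};
    spec_pieces : {in pieces st, forall u, kj u \in chosen st /\
      exists x, [/\ x \in s, kj u = xi x, kc u = xs x, 0 <= kh u < m
        & xr x <= ka u /\ ka u <= kb u <= xd x]};
    spec_once : forall j i, (count (runs_at j i) (pieces st) <= 1)%N;
    spec_work : {in s, forall x, xi x \in chosen st -> work (pieces st) (xi x) = xp x};
    spec_potential : forall r d, potential Q (segs st) r d <=
      2 * area (fun x => (xi x \in chosen st) && meets r d x) s;
    spec_gain : gain st = \sum_(x <- s | xi x \in chosen st) xw x
  }.

(** * Preservation of the invariant by one placement *)

Section Place.

Variables (m Q : int) (nar : bool).
Hypotheses (m_gt0 : 0 < m) (Q_ge0 : 0 <= Q).

Notation spec := (state_spec m Q nar).

Lemma init_spec : spec [::] (State [:: Segment (- Q) Q 0 0] [::] [::] 0).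
Proof.
split=> //=.
- by rewrite eqxx eqxx andbT; lia.
- by move=> g; rewrite inE => /eqP-> /=; split=> /=; [lia|lia|case: nar => //; left].
- move=> g; rewrite inE => /eqP-> t _ /=; split=> [h|h _|]; by rewrite /load big_nil.
- by move=> r d; rewrite /potential /area big_seq1 big_nil /= mul0r !addr0 mulr0.
- by rewrite big_nil.
Qed.

Lemma spec_cons x s st : xi x \notin map xi s -> spec s st -> spec (x :: s) st.
Proof.
move=> xs' [H1 H2 H3 H4 H5 H6 H7 H8 H9].
have xst : (xi x \in chosen st) = false by apply: contraNF xs' => /H4.
split=> //.
- by move=> j /H4 jm; rewrite /= inE jm orbT.
- move=> u /H5[uc [y [ys E]]]; split=> //; exists y.
  by rewrite inE ys orbT.
- by move=> y; rewrite inE => /predU1P[->|/H7//]; rewrite xst.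
- by move=> r d; rewrite /area big_cons xst.
- by rewrite big_cons xst.
Qed.

(** [state_spec] never reads the residual profits, so a state for a reweighted list is also one for
    the original list. *)
Lemma spec_map f s st :
  (forall x, [/\ xi (f x) = xi x, xr (f x) = xr x & xd (f x) = xd x]) ->
  (forall x, [/\ xp (f x) = xp x, xs (f x) = xs x & xw (f x) = xw x]) ->
  spec (map f s) st -> spec s st.
Proof.
move=> fE fE' [H1 H2 H3 H4 H5 H6 H7 H8 H9].
have f_i x : xi (f x) = xi x by case: (fE x).
have f_r x : xr (f x) = xr x by case: (fE x).
have f_d x : xd (f x) = xd x by case: (fE x).
have f_p x : xp (f x) = xp x by case: (fE' x).
have f_s x : xs (f x) = xs x by case: (fE' x).
split=> //.
- by move=> j /H4; rewrite -map_comp (eq_map (g := xi)).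
- move=> u /H5[uc [_ [/mapP[y ys ->] E1 E2 E3 E4]]]; split=> //; exists y.
  by move: E1 E2 E3 E4; rewrite f_i f_s f_r f_d.
- by move=> x xs' xc; have := H7 (f x) (map_f f xs'); rewrite f_i f_p => ->.
- move=> r d; apply: le_trans (H8 r d) _; rewrite /area big_map.
  rewrite le_eqVlt; apply/orP; left; apply/eqP; congr (2 * _).
  by apply: eq_big => x; rewrite /meets ?f_i ?f_r ?f_d ?f_s ?f_p.
- by rewrite H9 big_map; apply: eq_big => x; rewrite ?f_i //; case: (fE' x).
Qed.

Lemma cut_mem c s g : g \in cut c s -> exists g', [/\ g' \in s, ga g' <= ga g,
  gb g <= gb g', gh g = gh g' & gl g = gl g'].
Proof.
elim: s => //= g0 s IH; case: ifP => [/andP[c1 c2]|_]; rewrite !inE.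
  case/or3P => [/eqP->|/eqP->|/IH[g' [H1 H2 H3 H4 H5]]].
  - by exists g0; split=> //=; rewrite ?mem_head //; lia.
  - by exists g0; split=> //=; rewrite ?mem_head //; lia.
  - by exists g'; split=> //; rewrite inE H1 orbT.
case/predU1P => [->|/IH[g' [H1 H2 H3 H4 H5]]]; first by exists g0; rewrite mem_head.
by exists g'; split=> //; rewrite inE H1 orbT.
Qed.

(** A failure is certified by the potential of the state before the placement: cutting preserves the
    potential, and a failed filling is discarded. *)
Lemma place_spec x s st : item_class Q nar x -> 0 <= xp x ->
  - Q <= xr x -> xr x <= xd x -> xd x <= Q -> xi x \notin map xi s ->
  spec s st -> let st' := place m Q x st in
  spec (x :: s) st' /\
  (chosen st' = xi x :: chosen st \/
   chosen st' = chosen st /\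
   m * Q * (xlen x - xp x) <= potential Q (segs st) (xr x) (xd x)).
Proof.
move=> Hx p0 Qr rd dQ xs' Hst st'; have [H1 H2 H3 H4 H5 H6 H7 H8 H9] := Hst.
have xst : (xi x \in chosen st) = false by apply: contraNF xs' => /H4.
set s2 := cut (xd x + 1) (cut (xr x) (segs st)).
have C1 : chain (- Q) s2 (Q + 1) by do 2!apply: chain_cut.
have mem2 g : g \in s2 -> exists g', [/\ g' \in segs st, ga g' <= ga g,
  gb g <= gb g', gh g = gh g' & gl g = gl g'].
  move=> /cut_mem[g1 [/cut_mem[g2 [? ? ? E1 E2]] ? ? E3 E4]]; exists g2.
  by rewrite E3 E4 E1 E2; split=> //; lia.
have C2 : {in s2, forall g, segment_class m Q nar g}.
  by move=> g /mem2[g' [/H2 + _ _ E1 E2]]; rewrite /segment_class E1 E2.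
have C3 : {in s2, forall g, loaded Q (load (pieces st)) g}.
  by move=> g /mem2[g' [/H3 L E1 E2 E3 E4]]; apply: loaded_sub L.
have P2 r d : potential Q s2 r d = potential Q (segs st) r d.
  by rewrite /s2 !potential_cut.
have := fillP m Q x s2 p0; rewrite /st' /place -/s2.
case: (fill m Q x (xp x) s2) => q [t k] /= F.
have [q0 Wk] := fill_work F; case: ifP => qle; last first.
  split; first exact: spec_cons.
  right; split=> //; rewrite -P2.
  have -> : xlen x = extent s2 (xr x) (xd x) by rewrite (extent_chain C1) //; lia.
  apply: (fill_failure Hx (ltW m_gt0) F) => //; first by lia.
  - by apply/allP => g gs; have [] := chain_mem C1 gs.
  - by apply: aligned_cut2; apply: aligned_cut.
  - exact: aligned_cut.
have {qle} qE : q = 0 by lia.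
have Fp := fill_pieces Hx F C1 C2.
split; last by left.
have oldj j u : u \in pieces st -> kj u = j -> j != xi x.
  by move=> /H5[uc _] <-; apply: contraFneq xst => <-.
split=> /=.
- exact: fill_chain F C1.
- exact: fill_class F C2.
- move=> g /(fill_loaded Hx F C1 C2 C3); apply: loaded_ext => h i _.
  by rewrite /load big_cat addrC.
- by move=> j; rewrite !inE => /predU1P[->|/H4->]; rewrite ?eqxx ?orbT.
- move=> u; rewrite mem_cat => /orP[/Fp[E1 E2 E3 _ E4]|/H5[uc [y [ys E1 E2 E3 E4]]]].
    by rewrite E1 mem_head; split=> //; exists x; rewrite mem_head.
  by rewrite inE uc orbT; split=> //; exists y; rewrite inE ys orbT.
- move=> j i; rewrite count_cat; case: (eqVneq j (xi x)) => [->|jx].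
    rewrite [X in (_ + X)%N](_ : _ = 0%N) ?addn0.
      apply: leq_trans (fill_once i Hx F C1 C2); apply: sub_count => u.
      by rewrite /runs_at => /andP[].
    apply/eqP; rewrite -leqn0 leqNgt -has_count; apply/hasPn => u uB.
    by rewrite /runs_at negb_and; case: eqP => // /(oldj _ _ uB); rewrite eqxx.
  rewrite [X in (X + _)%N](_ : _ = 0%N) ?add0n //.
  apply/eqP; rewrite -leqn0 leqNgt -has_count; apply/hasPn => u uB.
  by rewrite /runs_at negb_and; have [-> _ _ _ _] := Fp u uB; rewrite eq_sym jx.
- have Wold : {in pieces st, forall u, kj u != xi x} by move=> u uB; apply: oldj uB _.
  move=> y; rewrite !inE => /predU1P[->|ys] yc; rewrite /work big_cat /=.
    rewrite [X in _ + X]big1_seq ?addr0.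
      rewrite big_seq_cond (eq_bigl (fun u => u \in k)) -?big_seq ?Wk ?qE ?subr0 // => u.
      by case uk: (u \in k) => //=; have [-> _ _ _ _] := Fp u uk; rewrite eqxx.
    by move=> u /andP[/eqP E /Wold]; rewrite E eqxx.
  have yx : xi y != xi x by apply: contraNneq xs' => <-; apply: map_f.
  rewrite (negPf yx) /= in yc; rewrite [X in X + _]big1_seq ?add0r; first exact: H7.
  by move=> u /andP[/eqP E /Fp[E' _ _ _ _]]; move: yx; rewrite -E E' eqxx.
- move=> r d; rewrite /area big_cons mem_head.
  have -> : \sum_(y <- s | (xi y \in xi x :: chosen st) && meets r d y) xs y * xp y =
      area (fun y => (xi y \in chosen st) && meets r d y) s.
    rewrite /area big_seq_cond [RHS]big_seq_cond; apply: eq_bigl => y.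
    case ys: (y \in s) => //=; rewrite inE; case: eqP => // E.
    by case/negP: xs'; rewrite -E map_f.
  have := fill_potential r d Hx F C2; rewrite P2; have := H8 r d.
  set A := area _ _; set S := \sum_(_ <- k) _.
  have xs0 : 0 <= xs x by case: Hx => /ltW.
  have SW : S <= \sum_(u <- k) piece_len u.
    rewrite /S !big_seq; apply: ler_sum => u /Fp[_ _ _ _].
    by rewrite /overlap /piece_len; lia.
  rewrite Wk qE subr0 in SW.
  case: ifP => mt /=.
    by have := ler_wpM2l xs0 SW; rewrite mulrDl; lia.
  (* The new pieces lie in the window of [x], which does not meet the window from [r] to [d]. *)
  have -> : S = 0.
    rewrite /S big1_seq // => u /andP[_ /Fp[_ _ _ _]].
    by move: mt; rewrite /meets /overlap; lia.
  by rewrite mulr0; lia.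
- rewrite big_cons mem_head H9 addrC; congr (_ + _).
  rewrite big_seq_cond [RHS]big_seq_cond; apply: eq_bigl => y.
  case ys: (y \in s) => //=; rewrite inE; case: eqP => // E.
  by case/negP: xs'; rewrite -E map_f.
Qed.

End Place.

(** * The local-ratio analysis *)

Section LocalRatio.

Variables (m Q K : int) (nar : bool).
Hypotheses (m_gt0 : 0 < m) (Q_gt0 : 0 < Q) (K_ge0 : 0 <= K).

Definition within (r d : int) (x : item) : bool := (r <= xr x) && (xd x <= d).

(** The last condition is the integral form of the slack: it follows from [p <= lam |chi|] and
    [K >= 2 / (1 - lam)]. *)
Definition item_good (x : item) : Prop :=
  [/\ item_class Q nar x, 0 <= xp x, - Q <= xr x /\ xd x <= Q, xr x <= xd x
    & xlen x + xlen x <= K * (xlen x - xp x)].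

Definition nested_after (x y : item) : bool :=
  meets (xr x) (xd x) y ==> within (xr x) (xd x) y.

Definition residual (P : int -> bool) (s : seq item) : int :=
  \sum_(x <- s | P (xi x)) xf x.

Lemma area_ge0 P s : {in s, forall x, item_good x} -> 0 <= area P s.
Proof.
move=> H; rewrite /area big_seq_cond sumr_ge0 // => x /andP[xs' _].
by have [[/ltW s0 _ _] p0 _ _ _] := H x xs'; apply: mulr_ge0.
Qed.

Lemma residual_reweights P x s :
  residual P (reweights m Q K x s) = residual P s * (m * Q * xlen x) -
    K * xf x * area (fun y => P (xi y) && within (xr x) (xd x) y) s.
Proof.
rewrite /residual /area /reweights big_map /= mulr_suml mulr_sumr.
rewrite [X in _ - X]big_mkcondr -sumrB; apply: eq_bigr => y _.
by rewrite /within; case: ifP; rewrite ?subr0.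
Qed.

(** All that is kept of feasibility is the area bound on every window. Being free of profits it
    survives reweighting, and it passes to the tail of the list, so the induction applies in both
    branches. *)
Lemma solve_spec n s : size s = n -> uniq (map xi s) ->
  {in s, forall x, item_good x} -> pairwise nested_after s ->
  let st := solve_rec m Q K n s in
  state_spec m Q nar s st /\
  forall P : int -> bool,
    (forall r d, r <= d ->
       area (fun x => P (xi x) && within r d x) s <= m * Q * (d - r + 1)) ->
    residual P s <= (1 + K) * residual (fun j => j \in chosen st) s.
Proof.
elim: n s => [|n IH] [|x s] //= sz.
  move=> _ _ _; split; first by apply: init_spec => //; apply: ltW.
  by move=> P _; rewrite /residual !big_nil mulr0.
case: sz => sz /andP[xs' us] Hg /andP[Hx Hs].
have Hg' : {in s, forall y, item_good y} by move=> y ys; apply: Hg; rewrite inE ys orbT.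
have Gx := Hg x (mem_head _ _).
have tail (P : int -> bool) r d :
    area (fun y => P (xi y) && within r d y) s <=
    area (fun y => P (xi y) && within r d y) (x :: s).
  rewrite /area big_cons; case: ifP => // _; rewrite ler_wpDl //.
  by have [[/ltW s0 _ _] p0 _ _ _] := Gx; apply: mulr_ge0.
have resE (P : int -> bool) : residual P (x :: s) = (if P (xi x) then xf x else 0) + residual P s.
  by rewrite /residual big_cons; case: ifP => _; rewrite ?add0r.
case: (lerP (xf x) 0) => f0.
  have [S1 S2] := IH s sz us Hg' Hs; split; first exact: spec_cons.
  have xst : (xi x \in chosen (solve_rec m Q K n s)) = false.
    by apply: contraNF xs' => /(spec_chosen S1).
  move=> P HP; rewrite !resE xst add0r.
  (* An item of nonpositive residual profit can only lower the left-hand side. *)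
  have := S2 P (fun r d rd => le_trans (tail P r d) (HP r d rd)).
  move: (residual P s) (_ * residual _ _) => a b.
  by case: (P (xi x)); lia.
set s' := reweights m Q K x s.
have sz' : size s' = n by rewrite size_reweights.
have us' : uniq (map xi s') by rewrite -map_comp (eq_map (g := xi)).
have Hg2 : {in s', forall y, item_good y} by move=> _ /mapP[y /Hg' + ->].
have Hs2 : pairwise nested_after s' by rewrite pairwise_map.
have areaE (Pr : item -> bool) : (forall r d g D y, Pr (reweight r d g D y) = Pr y) -> area Pr s' = area Pr s.
  by move=> E; rewrite /area /s' /reweights big_map; apply: eq_bigl => y; apply: E.
have [S1 S2] := IH s' sz' us' Hg2 Hs2; set st := solve_rec m Q K n s' in S1 S2 *.
have S1' : state_spec m Q nar s st.
  by move: S1; apply: spec_map => y.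
have [cx p0 [Qr dQ] rd slk] := Gx.
have [S3 S4] := place_spec m_gt0 (ltW Q_gt0) cx p0 Qr rd dQ xs' S1'.
split=> // P HP.
have D0 : 0 < m * Q * xlen x by rewrite !mulr_gt0 // /xlen; lia.
have HP' r d : r <= d -> area (fun y => P (xi y) && within r d y) s' <= m * Q * (d - r + 1).
  by move=> le_rd; rewrite areaE //; apply: le_trans (tail P r d) (HP r d le_rd).
have := S2 P HP'; rewrite !residual_reweights.
have := le_trans (tail P (xr x) (xd x)) (HP _ _ rd); rewrite -/(xlen x).
set aP := area _ s; set aS := area (fun y => (xi y \in chosen st) && _) s => areaP ratio.
have xst : (xi x \in chosen st) = false by apply: contraNF xs' => /(spec_chosen S1').
have aS0 : 0 <= aS by apply: area_ge0.
have Kf0 : 0 <= K * xf x by rewrite mulr_ge0 // ltW.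
(* Everything is multiplied by [m * Q * xlen x]. The new state is worth at least the reweighted
   value of the recursive one plus [xf x]: if [x] was added, by its own profit; otherwise because
   [aS] is so large that undoing the reweighting gains [xf x]. *)
have key : m * Q * xlen x * residual (fun j => j \in chosen st) s + xf x * (m * Q * xlen x)
    - K * xf x * aS <= m * Q * xlen x * residual (fun j => j \in chosen (place m Q x st)) (x :: s).
  rewrite resE; case: S4 => [->|[-> fail]].
    rewrite mem_head.
    have -> : residual (fun j => j \in xi x :: chosen st) s = residual (fun j => j \in chosen st) s.
      rewrite /residual big_seq_cond [RHS]big_seq_cond; apply: eq_bigl => y.
      case ys: (y \in s) => //=; rewrite inE; case: eqP => // E.
      by case/negP: xs'; rewrite -E map_f.
    have := mulr_ge0 Kf0 aS0; move: (m * Q * xlen x) (K * xf x * aS) => D c.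
    by rewrite mulrDr [xf x * D]mulrC; move: (D * residual _ _) (D * xf x) => a b; lia.
  rewrite xst add0r.
  (* By [nested_after], the items meeting the window of [x] lie within it. *)
  have A2 : potential Q (segs st) (xr x) (xd x) <= 2 * aS.
    apply: le_trans (spec_potential S1' _ _) _; rewrite ler_pM2l //.
    rewrite /aS /area big_seq_cond [X in _ <= X]big_seq_cond le_eqVlt; apply/orP; left; apply/eqP.
    apply: eq_bigl => y; case ys: (y \in s) => //=; congr andb.
    have /implyP := allP Hx y ys; rewrite /within /meets; have [_ _ _ ryd _] := Hg' y ys.
    by move=> W; apply/idP/idP => //; lia.
  have : m * Q * (xlen x + xlen x) <= K * (2 * aS).
    apply: le_trans (_ : m * Q * (K * (xlen x - xp x)) <= _).
      by rewrite ler_wpM2l // ltW // mulr_gt0.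
    by rewrite mulrCA ler_wpM2l //; apply: le_trans fail A2.
  rewrite mulrDr mulrCA => B.
  have {}B : m * Q * xlen x <= K * aS by move: B; clear; lia.
  have := ler_wpM2l (ltW f0) B.
  have -> : xf x * (K * aS) = K * xf x * aS by ring.
  by move: (xf x * _) (K * xf x * aS) (_ * residual _ _) => a b c; lia.
have : residual P (x :: s) <= xf x + residual P s by rewrite resE; case: (P (xi x)); lia.
rewrite -/s' in key *.
move=> R1; rewrite -(ler_pM2l D0).
have := ler_wpM2l Kf0 areaP; have := ler_wpM2l (ltW D0) R1.
have := ler_wpM2l (addr_ge0 ler01 K_ge0) key.
move: ratio; set rS := residual (fun j => j \in chosen st) s.
set rP := residual P s; set rS' := residual _ (x :: s); set rP' := residual P _.
move: (m * Q * xlen x) (xf x) D0 f0; move: K => k D f _ _.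
clearbody aP aS rS rP rS' rP'; clear => H1 H2 H3 H4.
(* After normalisation the claim is linear in the monomials: the loss [f * D + k * f * D] of [P] is
   [1 + k] times the surplus [f * D] of [key]. *)
have -> : D * ((1 + k) * rS') = (1 + k) * (D * rS') by ring.
have E1 : (1 + k) * (rS * D - k * f * aS) = (1 + k) * (D * rS - k * f * aS) by ring.
have E2 : (1 + k) * (D * rS + f * D - k * f * aS) = (1 + k) * (D * rS - k * f * aS) + (1 + k) * (f * D) by ring.
rewrite E1 in H1; rewrite E2 in H2.
have E3 : (1 + k) * (f * D) = f * D + k * f * D by ring.
have E4 : D * (f + rP) = f * D + rP * D by ring.
by rewrite E3 in H2; rewrite E4 in H3; move: H1 H2 H3 H4; lia.
Qed.

End LocalRatio.

(** * Size bounds and running time *)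

Definition enc_answer (st : state) : value :=
  VPair (enc_seq VInt (chosen st)) (enc_seq enc_piece (pieces st)).

Lemma run_main (K M : int) (L : nat) (I : instance) :
  let N := vsize (enc_instance I) in let n := njobs I in
  let Q := scale (jobs I) in
  1 <= M -> n%:Z <= M -> 0 <= (hosts I)%:Z <= M -> ints M (enc_seq enc_job (jobs I)) ->
  (forall i, 0 <= scale (drop i (jobs I)) <= M) ->
  ((n + 2) * (3 * n + 5) <= L)%N ->
  (forall c, let s := items c Q 0 (jobs I) in
     [/\ all (item_ok M) s, traced K M (hosts I)%:Z Q (size s) s,
         all (fun x => `|xd x + 1| <= M) s & gains s <= M]) ->
  callb (prog K) (size_bound M L) 0 (enc_instance I) (enc_answer (answer K I))
    (2 * ((n + 1) * (4 * L + 6)) + 2 * ((n + 1) * (n + 1)) + n + 2).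
Proof.
move=> N n Q M1 nM mM HjM HQ HL Hit.
have szj : size (jobs I) = n by rewrite size_tuple.
have Q0 : 0 <= Q <= M by have := HQ 0%N; rewrite drop0.
have nL : (n + n + 2 < L)%N by apply: leq_trans HL; nia.
have Hj : all (fun j => ints M (enc_job j)) (jobs I).
  by move: HjM; rewrite ints_seq //; lia.
have szi c : (size (items c Q 0 (jobs I)) <= n)%N by rewrite -szj size_items.
have HLi c : ((size (items c Q 0 (jobs I)) + 2) * (3 * size (items c Q 0 (jobs I)) + 5) <= L)%N.
  by apply: leq_trans HL; have := szi c; nia.
pose st c := solve (hosts I)%:Z Q K (items c Q 0 (jobs I)).
have Hst c : ints M (enc_state (st c)) /\ (leaves (enc_state (st c)) <= 9 * L + 4)%N.
  have [H1 H2 H3 H4] := Hit c.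
  have [_ S2 [S3 S4 S5 S6]] := solve_state_ok M1 mM Q0 erefl H2 H3 H4.
  have HLc := HLi c.
  apply: (state_size M1 mM Q0) => //; rewrite /st /solve;
    move: (size (items _ _ _ _)) S4 S5 S6 HLc => k S4 S5 S6 HLc;
    [apply: leq_trans S4 _|apply: leq_trans S5 _|apply: leq_trans S6 _];
    apply: leq_trans HLc; clear; nia.
have Hrun c : callb (prog K) (size_bound M L) f_solve
    (VPair (VPair (VInt (hosts I)%:Z) (VInt Q)) (enc_seq enc_item (items c Q 0 (jobs I))))
    (enc_state (st c)) ((n + 1) * (4 * L + 6)).
  have [H1 H2 H3 H4] := Hit c.
  apply: callb_leq (run_solve M1 mM Q0 erefl H2 H3 H4 (HLi c)) _.
  by rewrite leq_mul2r leq_add2r szi orbT.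
have Hits c : callb (prog K) (size_bound M L) f_items
    (VPair (VInt (nat_of_bool c)%:Z) (VPair (VInt Q) (VPair (VInt 0) (enc_seq enc_job (jobs I)))))
    (enc_seq enc_item (items c Q 0 (jobs I))) ((n + 1) * (n + 1)).
  have [H1 _ _ _] := Hit c; rewrite addn1 -szj; apply: run_items => //; rewrite ?szj; lia.
have ansE : answer K I = best (st true) (st false) by [].
apply: (@callbI _ _ _ b_main) => //.
- apply: size_boundP; first by rewrite /= leaves_enc szj; lia.
  by rewrite ints_pair HjM /=; lia.
- apply: size_boundP.
    rewrite /= !leaves_enc.
    have [_ +] := Hst true; have [_ +] := Hst false; rewrite ansE /best /= !leaves_enc.
    by case: ifP => _; lia.
  have [+ _] := Hst true; have [+ _] := Hst false; rewrite ansE /best /enc_state !ints_pair /=.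
  by case: ifP => _ /and4P[_ Ha Hb _] /and4P[_ Hc Hd _]; apply/andP.
rewrite /b_main /elen /enth /etl /=.
exists (VInt Q), n.+1; split.
  rewrite -szj; apply: run_scale => //; first by rewrite szj; lia.
  by move=> i; have := HQ i; lia.
exists (enc_seq enc_item (items true Q 0 (jobs I))), ((n + 1) * (n + 1))%N; split.
  exact: (Hits true).
exists (enc_state (st true)), ((n + 1) * (4 * L + 6))%N; split; first exact: Hrun.
exists (enc_seq enc_item (items false Q 0 (jobs I))), ((n + 1) * (n + 1))%N; split.
  exact: (Hits false).
exists (enc_state (st false)), ((n + 1) * (4 * L + 6))%N; split; first exact: Hrun.
rewrite ansE /best /=; case: (gain (st false) <= gain (st true)) => /=.
all: by split=> //; move: ((n + 1) * (4 * L + 6))%N ((n + 1) * (n + 1))%N; clear; lia.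
Qed.

Lemma ints_leq M M' v : M <= M' -> ints M v -> ints M' v.
Proof.
move=> MM'; elim: v => [z|v1 IH1 v2 IH2] /=; first by lia.
by move=> /andP[/IH1-> /IH2->].
Qed.

Lemma exp2z k : 2 ^+ k = (2 ^ k)%N%:Z.
Proof. by rewrite -natz natrX. Qed.

Lemma ints_vsize v : ints (2 ^+ vsize v) v.
Proof.
have up k l v' : (k <= l)%N -> ints (2 ^+ k) v' -> ints (2 ^+ l) v'.
  by move=> kl; apply: ints_leq; rewrite ler_weXn2l.
elim: v => [z|v1 IH1 v2 IH2].
  have := absz_lt_exp z; rewrite [ints _ _]/= exp2z /vsize !expnS.
  by move: (2 ^ _)%N => e; lia.
by rewrite /=; apply/andP; split; [apply: up IH1|apply: up IH2]; lia.
Qed.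

Lemma vsize_seq_drop T (enc : T -> value) i s :
  (vsize (enc_seq enc (drop i s)) <= vsize (enc_seq enc s))%N.
Proof.
by elim: s i => [|x s IH] [|i] //=; apply: leq_trans (IH i) _; lia.
Qed.

Lemma size_vsize_seq T (enc : T -> value) s : (size s < vsize (enc_seq enc s))%N.
Proof. by elim: s => //= x s IH; lia. Qed.

(** With [e >= 4] bounding the integers of the job, each denominator accounts for one factor [e] and
    the dates for three, as [1 + 2 e^2 <= 4 e^2 <= e^3]. *)
Lemma scale_factor_bound j : 1 <= scale_factor j <= 2 ^+ (5 * vsize (enc_job j)).
Proof.
have := ints_vsize (enc_job j); set e : int := 2 ^+ vsize _ => He.
have e4 : 4 <= e.
  have : 2 ^+ 2 <= e by rewrite /e ler_weXn2l //= !ltnS; lia.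
  by rewrite expr2; lia.
rewrite mulnC exprM -/e /scale_factor.
have d1 := denq_gt0 (demand j); have d2 := denq_gt0 (profit j).
move: He; rewrite /= => He.
have s1 : denq (demand j) <= e by move: He; clear -d1; lia.
have s2 : denq (profit j) <= e by move: He; clear -d2; lia.
have r2 : release j * release j <= e * e.
  by rewrite -[release j * _]ger0_norm ?normrM ?ler_pM ?sqr_ge0 //; move: He; clear; lia.
have dd2 : deadline j * deadline j <= e * e.
  by rewrite -[deadline j * _]ger0_norm ?normrM ?ler_pM ?sqr_ge0 //; move: He; clear; lia.
have r0 : 0 <= release j * release j by rewrite -expr2 sqr_ge0.
have dd0 : 0 <= deadline j * deadline j by rewrite -expr2 sqr_ge0.
set w := 1 + _ + _; have w1 : 1 <= w by rewrite /w; lia.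
have we : w <= e ^+ 3.
  apply: le_trans (_ : e * e * 4 <= _); first by have : 1 <= e * e by [clear -e4; nia]; rewrite /w; clear -r2 dd2; lia.
  by rewrite !exprS expr0 mulr1 mulrA ler_wpM2l //; apply: mulr_ge0; lia.
apply/andP; split; first by clear -d1 d2 w1; nia.
have -> : e ^+ 5 = e * e * e ^+ 3 by ring.
by rewrite !ler_pM //; try lia; apply: mulr_ge0; lia.
Qed.

(** Sizes of encodings add up along the list, so the product over all jobs still has linear bit
    length. *)
Lemma scale_bound s : 1 <= scale s <= 2 ^+ (5 * vsize (enc_seq enc_job s)).
Proof.
elim: s => [|j s IH] /=; first by rewrite exprn_ege1.
have /andP[a1 a2] := scale_factor_bound j; have /andP[b1 b2] := IH.
apply/andP; split; first by clear -a1 b1; nia.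
apply: le_trans (_ : 2 ^+ (5 * vsize (enc_job j)) * 2 ^+ (5 * vsize (enc_seq enc_job s)) <= _).
  by apply: ler_pM => //; lia.
by rewrite -exprD ler_weXn2l //=; lia.
Qed.

(** * Growth of the residual profits *)

Section Traced.

Variables (K m Q M G : int).
Hypotheses (K_ge0 : 0 <= K) (m_ge0 : 0 <= m) (Q_ge0 : 0 <= Q).

(* [G] bounds the growth of the residual profits in one local-ratio step. *)
Definition growth_ok (x : item) : bool :=
  [&& [&& `|xi x| <= M, `|xr x| <= M, `|xd x| <= M, `|xp x| <= M, `|xs x| <= M
        & `|xw x| <= M], 0 <= xp x & 0 <= xs x].

(** With [D = m * Q * xlen x], a step turns a residual profit into at worst
    [xf y * D - K * xf x * (xs y * xp y)], of absolute value at most [F * G]. The bit length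
    therefore grows linearly with the number of steps. *)
Lemma growth_traced n s F : size s = n -> K + 1 <= G ->
  {in s, forall x, growth_ok x} ->
  {in s & s, forall x y, K * (xs x * xp x) + `|m * Q * xlen y| <= G} ->
  {in s, forall x, `|xf x| <= F} -> 0 <= F -> F * G ^+ n <= M -> G <= M ->
  traced K M m Q n s.
Proof.
move=> + KG; elim: n s F => [|n IH] [|x s] F //= [sz] Hs Hss Hf F0 FM GM.
have G1 : 1 <= G by lia.
have Gn : 1 <= G ^+ n by rewrite exprn_ege1.
have FM' : F * G * G ^+ n <= M by rewrite -mulrA -exprS.
have FG : F * G <= M.
  by apply: le_trans FM'; rewrite ler_peMr // mulr_ge0 //; lia.
have FleM : F <= M by apply: le_trans FG; rewrite ler_peMr.
split.
  suff: all (item_ok M) (x :: s) by [].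
  apply/allP => y ys; have := Hs y ys; have := Hf y ys; rewrite /growth_ok /item_ok /=.
  by clear -FleM; lia.
have Hs' : {in s, forall y, growth_ok y} by move=> y ys; apply: Hs; rewrite inE ys orbT.
have Hss' : {in s & s, forall x y, K * (xs x * xp x) + `|m * Q * xlen y| <= G}.
  by move=> y z ys zs; apply: Hss; rewrite inE ?ys ?zs orbT.
have Hf' : {in s, forall y, `|xf y| <= F} by move=> y ys; apply: Hf; rewrite inE ys orbT.
case: ifP => _.
  apply: (IH s F) => //; apply: le_trans FM; rewrite exprS mulrA.
  by rewrite ler_wpM2r ?ler_peMr //; lia.
have Hx := Hf x (mem_head _ _).
split.
- rewrite normrM ger0_norm //; apply: le_trans FG; rewrite mulrC.
  by apply: ler_pM => //; lia.
- apply: le_trans GM; have := Hss x x (mem_head _ _) (mem_head _ _).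
  have /and3P[_ p0 s0] := Hs x (mem_head _ _).
  have : 0 <= K * (xs x * xp x) by rewrite mulr_ge0 ?mulr_ge0.
  by lia.
apply: (IH _ (F * G)) => //.
- by rewrite size_reweights.
- by move=> _ /mapP[y /Hs' + ->].
- by move=> _ _ /mapP[y ys ->] /mapP[z zs ->]; exact: (Hss' y z ys zs).
- move=> _ /mapP[y ys ->] /=; set D := m * Q * xlen x.
  have {}Hy := Hf' y ys.
  have := Hss y x; rewrite inE ys orbT mem_head => /(_ isT isT); rewrite -/D => HG.
  have /and3P[_ p0 s0] := Hs' y ys.
  have a0 : 0 <= xs y * xp y by rewrite mulr_ge0.
  have E1 : `|xf y * D| <= F * `|D| by rewrite normrM ler_wpM2r.
  have E2 : `|K * xf x * (xs y * xp y)| <= F * (K * (xs y * xp y)).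
    rewrite !normrM (ger0_norm K_ge0) [`|xs y|]ger0_norm // [`|xp y|]ger0_norm //.
    rewrite [K * `|_|]mulrC -mulrA ler_wpM2r // mulr_ge0 //.
  have E3 : F * (K * (xs y * xp y)) + F * `|D| <= F * G by rewrite -mulrDr ler_wpM2l.
  have E4 : 0 <= F * (K * (xs y * xp y)) by rewrite mulr_ge0 ?mulr_ge0.
  case: ifP => _; last by lia.
  apply: le_trans (ler_normB _ _) _; lia.
- by rewrite mulr_ge0 //; lia.
Qed.

End Traced.

(** * Instances *)

Lemma perm_insert_cons x s : perm_eq (insert x s) (x :: s).
Proof.
have [s1 [s2 [-> ->]]] := perm_insert x s.
by rewrite perm_catC /= perm_cons perm_catC.
Qed.

Definition longer (x y : item) : bool := xlen y <= xlen x.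

Lemma insert_sorted x s : pairwise longer s -> pairwise longer (insert x s).
Proof.
elim: s => //= y s IH /andP[Hy Hs]; case: (lerP (xlen y) (xlen x)) => [yx|xy] /=.
  rewrite Hy Hs !andbT /longer yx /=; apply/allP => z zs.
  by have := allP Hy z zs; rewrite /longer; lia.
by rewrite IH // all_insert Hy andbT /longer ltW.
Qed.

Lemma items_sorted c Q i s : pairwise longer (items c Q i s).
Proof.
elim: s i => //= j s IH i; case: ifP => _; last exact: IH.
exact: insert_sorted.
Qed.

Lemma items_perm c Q i s j0 : perm_eq (items c Q i s)
  [seq item_of c Q (i + k%:Z) (nth j0 s k) | k <- iota 0 (size s) & narrow (nth j0 s k) == c].
Proof.
elim: s i => //= j s IH i.
rewrite -[1%N]/(1 + 0)%N iotaDl filter_map.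
have E : perm_eq (items c Q (i + 1) s)
    [seq item_of c Q (i + ((1 + k)%N)%:Z) (nth j0 (j :: s) (1 + k)) | k <- iota 0 (size s)
       & narrow (nth j0 s k) == c].
  apply: perm_trans (IH _) _; rewrite (eq_map (g := fun k => item_of c Q (i + (1 + k)%N%:Z) (nth j0 (j :: s) (1 + k)))) // => k.
  by rewrite PoszD addrA.
case: ifP => _; rewrite /= -map_comp; last exact: E.
by rewrite addr0; apply: perm_trans (perm_insert_cons _ _) _; rewrite perm_cons.
Qed.

Section Instance.

Variables (I : instance) (c : bool).
Let n := njobs I.
Let Q := scale (jobs I).
Notation job := (@job_at I).
Notation its := (items c Q 0 (jobs I)).

Definition item_at (j : 'I_(njobs I)) : item :=
  item_of c (scale (jobs I)) (val j)%:Z (job_at j).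

Lemma items_enum : perm_eq its [seq item_at j | j <- enum 'I_n & narrow (job j) == c].
Proof.
case: (posnP n) => [n0|n_gt0].
  have -> : enum 'I_n = [::] by apply: size0nil; rewrite size_enum_ord.
  by have -> : tval (jobs I) = [::] by apply: size0nil; rewrite size_tuple.
pose j0 := job (Ordinal n_gt0).
apply: perm_trans (items_perm _ _ _ _ j0) _.
rewrite size_tuple -val_enum_ord filter_map -map_comp.
rewrite [X in perm_eq X _](_ : _ = [seq item_at j | j <- enum 'I_n & narrow (job j) == c]) //.
rewrite (@eq_filter _ _ (fun j => narrow (job j) == c)) => [|j]; last first.
  by rewrite /= /job_at (tnth_nth j0).
by apply: eq_map => j; rewrite /= add0r /item_at /job_at (tnth_nth j0).
Qed.

Lemma big_items (P : item -> bool) (F : item -> int) :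
  \sum_(x <- its | P x) F x =
  \sum_(j | (narrow (job j) == c) && P (item_at j)) F (item_at j).
Proof.
by rewrite (perm_big _ items_enum) big_map big_filter_cond big_enum_cond.
Qed.

Lemma itemsP x : x \in its -> exists2 j, narrow (job j) == c & x = item_at j.
Proof.
rewrite (perm_mem items_enum) => /mapP[j]; rewrite mem_filter => /andP[jc _] ->.
by exists j.
Qed.

Lemma mem_items j : narrow (job j) == c -> item_at j \in its.
Proof.
by move=> jc; rewrite (perm_mem items_enum) map_f // mem_filter jc mem_enum.
Qed.

Lemma items_uniq : uniq (map xi its).
Proof.
rewrite (perm_uniq (perm_map xi items_enum)) -map_comp map_inj_uniq.
  by rewrite filter_uniq // enum_uniq.
by move=> j j' /= [] /val_inj.
Qed.

Lemma scale_gt0 : 0 < Q.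
Proof. by have /andP[] := scale_bound (jobs I); rewrite /Q; lia. Qed.

Lemma dvd_scale_factor j : (scale_factor (job j) %| Q)%Z.
Proof.
rewrite /job_at (tnth_nth (job j)) /Q.
have : (j < size (jobs I))%N by rewrite size_tuple.
move: (job j) => j0; elim: (tval (jobs I)) (val j) => [|j1 s IH] [|k] //=.
  by move=> _; apply: dvdz_mulr.
by move=> /IH; apply: dvdz_mull.
Qed.

Lemma scale_factor_leq j : scale_factor (job j) <= Q.
Proof.
have /dvdzP[q E] := dvd_scale_factor j; have := scale_gt0; rewrite E.
have /andP[f1 _] := scale_factor_bound (job j); move: (scale_factor _) f1 => f f1 H.
have : 0 < q by rewrite pmulr_lgt0 in H; lia.
by clear -f1; nia.
Qed.

Lemma square_scale j : 1 + release (job j) * release (job j) +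
  deadline (job j) * deadline (job j) <= Q.
Proof.
have := scale_factor_leq j; rewrite /scale_factor.
have d1 := denq_gt0 (demand (job j)); have d2 := denq_gt0 (profit (job j)).
set w := 1 + _ + _; apply: le_trans.
have w0 : 0 <= w by rewrite /w -!expr2 !addr_ge0 ?sqr_ge0.
by rewrite ler_peMl //; clear -d1 d2; nia.
Qed.

Lemma release_scale j : - Q <= release (job j).
Proof. by have := square_scale j; clear; nia. Qed.

Lemma deadline_scale j : deadline (job j) <= Q.
Proof. by have := square_scale j; clear; nia. Qed.

Lemma numq_scaled (q : rat) : (denq q %| Q)%Z ->
  ((numq q * Q %/ denq q)%Z)%:~R = q * Q%:~R :> rat.
Proof.
move=> /dvdzP[u ->]; rewrite mulrA mulzK ?denq_neq0 //.
by rewrite !intrM numqE -mulrA [_ * u%:~R]mulrC.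
Qed.

Definition rounded (j : 'I_(njobs I)) : rat := if c then demand (job j) else 1.

Lemma xs_item_at j : (xs (item_at j))%:~R = rounded j * Q%:~R.
Proof.
rewrite /item_at /rounded /=; case: c; last by rewrite mul1r.
apply: numq_scaled; apply: dvdz_trans (dvd_scale_factor j).
by rewrite /scale_factor -mulrA dvdz_mulr.
Qed.

Lemma xw_item_at j : (xw (item_at j))%:~R = profit (job j) * Q%:~R.
Proof.
apply: numq_scaled; apply: dvdz_trans (dvd_scale_factor j).
by rewrite /scale_factor dvdz_mulr // dvdz_mull.
Qed.

Lemma narrowE j : narrow (job j) = (demand (job j) + demand (job j) <= 1).
Proof.
rewrite /narrow -(ler_int rat) intrD numqE -mulrDl.
have d0 : 0 < (denq (demand (job j)))%:~R :> rat by rewrite ltr0z denq_gt0.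
by rewrite -{2}[(denq _)%:~R]mul1r ler_pM2r.
Qed.

Hypothesis wf : wf_instance I.

Variable K : int.
Hypothesis K_slack : forall j, let x := item_at j in xlen x + xlen x <= K * (xlen x - xp x).

Lemma item_at_good j : narrow (job j) == c -> item_good Q K c (item_at j).
Proof.
move=> jc; have [rd p0 /andP[s0 s1] w0] := wf.2 j.
have Q0 : 0 < Q%:~R :> rat by rewrite ltr0z scale_gt0.
have Hs : (xs (item_at j))%:~R = (if c then demand (job j) else 1) * Q%:~R := xs_item_at j.
split=> //.
- split.
  + rewrite -(ltr_int rat) Hs mulr_gt0 //; by case: c.
  + by rewrite -(ler_int rat) Hs ger_pMl //; case: c.
  + case: c jc Hs => /eqP jc Hs; last by apply/eqP; rewrite -(eqr_int rat) Hs mul1r.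
    rewrite -(ler_int rat) intrD Hs -mulrDl ger_pMl // -narrowE jc //.
- by split; [exact: release_scale|exact: deadline_scale].
Qed.

Lemma items_good : {in its, forall x, item_good Q K c x}.
Proof. by move=> x /itemsP[j jc ->]; apply: item_at_good. Qed.

Hypothesis lam_inst : laminar I.

Lemma items_nested : pairwise nested_after its.
Proof.
have := items_sorted c Q 0 (jobs I).
apply: (@sub_in_pairwise _ (mem its)); last exact/allP.
move=> x y xits yits; case/itemsP: (xits) => j jc xE; case/itemsP: (yits) => k kc yE.
rewrite /longer /nested_after => len; apply/implyP => mt.
have [_ _ _ rx _] := items_good xits; have [_ _ _ ry _] := items_good yits.
have wE z (l : 'I_n) : (z \in window (job l)) = (xr (item_at l) <= z <= xd (item_at l)) by [].
case: (lam_inst j k) => [sub|sub|dis].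
(* The window of [x] is contained in that of [y] but at least as long, so the two coincide. *)
- have := sub (xr x); have := sub (xd x); rewrite !wE -xE -yE => H1 H2.
  have {}H1 := H1 ltac:(lia); have {}H2 := H2 ltac:(lia).
  by move: len; rewrite /xlen /within; lia.
- have := sub (xr y); have := sub (xd y); rewrite !wE -xE -yE => H1 H2.
  have {}H1 := H1 ltac:(lia); have {}H2 := H2 ltac:(lia).
  by rewrite /within; lia.
(* The later of the two release dates would be a common slot. *)
- by case: (dis (Num.max (xr x) (xr y))); rewrite !wE -xE -yE; move: mt; rewrite /meets; lia.
Qed.

End Instance.

(** * Upper bound: every feasible set respects the areas *)

Section Area.

Variables (I : instance) (c : bool).
Let n := njobs I.
Notation job := (@job_at I).
Notation its := (items c (scale (jobs I)) 0 (jobs I)).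

Hypothesis wf : wf_instance I.

Let demand_gt0 (j : 'I_n) : 0 < demand (job j).
Proof. by have [_ _ /andP[]] := wf.2 j. Qed.

Lemma rounded_ge0 (j : 'I_n) : 0 <= rounded c j.
Proof. by rewrite /rounded; case: c => //; apply: ltW. Qed.

(** Two jobs of demand above 1/2 exceed a host, so at most one wide job runs on a host in a slot,
    and rounding it up stays within the capacity. *)
Lemma rounded_load (A : {set 'I_n}) : \sum_(j in A) demand (job j) <= 1 ->
  \sum_(j in A | narrow (job j) == c) rounded c j <= 1.
Proof.
move=> HA; have sub (P : pred 'I_n) : \sum_(j in A | P j) demand (job j) <= 1.
  by apply: le_trans HA; rewrite [X in _ <= X](bigID P) /= ler_wpDr // sumr_ge0 // => j _; apply: ltW.
rewrite /rounded; case: c => /=; first exact: sub.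
pose W := [set j in A | narrow (job j) == false].
have HW : \sum_(i in W) demand (job i) <= 1.
  apply: le_trans (sub (fun j => narrow (job j) == false)).
  by rewrite (eq_bigl (fun j => (j \in A) && (narrow (job j) == false))) // => j; rewrite !inE.
rewrite (eq_bigl (fun j => j \in W)) => [|j]; last by rewrite !inE.
rewrite sumr_const lern1 leqNgt; apply/negP => /card_gt1P[j [k [jW kW jk]]].
move: HW; rewrite (bigD1 j jW) (bigD1 k); last by apply/andP; split=> //; rewrite eq_sym.
rewrite /=.
have r0 : 0 <= \sum_(i in W | (i != j) && (i != k)) demand (job i).
  by rewrite sumr_ge0 // => i _; apply: ltW.
have Wide i : i \in W -> 1 < demand (job i) + demand (job i).
  by rewrite inE narrowE => /andP[_ /eqP/negbT]; rewrite -ltNge.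
rewrite (eq_bigl (fun i => (i \in W) && ((i != j) && (i != k)))) => [|i]; last by rewrite andbA.
have := Wide j jW; have := Wide k kW.
by move: r0; move: (\sum_(_ in _ | _) _) (demand _) (demand _) => a b d; lra.
Qed.

Lemma slots_leq (S : {set 'I_n}) sigma (r d : int) (j : 'I_n) : is_schedule_of S sigma ->
  j \in S -> r <= release (job j) -> deadline (job j) <= d ->
  (proc (job j) <= \sum_(k < `|(d - r + 1)%R|%N) \sum_(i < hosts I) (j \in sigma i (r + k%:Z)%R))%N.
Proof.
move=> [_ Hwin _ _ Hrun] jS rj dj; have [T [uT pT HT]] := Hrun j jS.
apply: leq_trans pT _.
pose B := [seq (r + k%:Z) | k : 'I_(`|(d - r + 1)%R|%N) <- enum 'I_(`|(d - r + 1)%R|%N)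
             & [exists i, j \in sigma i (r + k%:Z)]].
have TB : {subset T <= B}.
  move=> t /HT[tw [i ji]]; move: tw; rewrite inE => /andP[t1 t2].
  have tk : (`|(t - r)%R| < `|(d - r + 1)%R|)%N by move: rj dj t1 t2; clear; lia.
  have tE : t = r + (val (Ordinal tk))%:Z by rewrite /=; move: rj t1; clear; lia.
  rewrite {1}tE; apply: (map_f (fun k : 'I__ => r + k%:Z)).
  by rewrite mem_filter mem_enum andbT; apply/existsP; exists i; rewrite -tE.
apply: leq_trans (uniq_leq_size uT TB) _; rewrite size_map size_filter.
rewrite -sum1_count big_enum_cond big_mkcond /=; apply: leq_sum => k _.
by case: existsP => // -[i ji]; rewrite (bigD1 i) //= ji.
Qed.

(** Double counting over the pairs of a slot and a host: by [rounded_load], each pair carries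
    rounded demand at most 1. *)
Lemma feasible_area (S : {set 'I_n}) (r d : int) : feasible S -> r <= d ->
  area (fun x => [exists j in S, (val j)%:Z == xi x] && within r d x) its <=
  (hosts I)%:Z * scale (jobs I) * (d - r + 1).
Proof.
move=> [sigma Hs] rd; have Q0 : 0 < (scale (jobs I))%:~R :> rat by rewrite ltr0z scale_gt0.
rewrite /area big_items -(ler_int rat).
have inS j : [exists j0 in S, (val j0)%:Z == xi (item_at c j)] = (j \in S).
  by apply/exists_inP/idP => [[k kS /eqP[/val_inj <-]]|jS] //; exists j.
pose ok j := [&& narrow (job j) == c, j \in S & within r d (item_at c j)].
rewrite (eq_bigl ok) => [|j]; last by rewrite inS.
rewrite raddf_sum /=.
have -> : \sum_(j | ok j) (xs (item_at c j) * xp (item_at c j))%:~R =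
    (scale (jobs I))%:~R * \sum_(j | ok j) rounded c j * (proc (job j))%:R.
  rewrite mulr_sumr; apply: eq_bigr => j _.
  by rewrite intrM xs_item_at mulrAC mulrA [_ * rounded c j]mulrC mulrAC -mulrA mulrCA mulrA.
rewrite [_%:Z * _]mulrC -mulrA intrM ler_pM2l //.
apply: le_trans (_ : \sum_(j | ok j) \sum_(k < `|(d - r + 1)%R|%N) \sum_(i < hosts I)
    rounded c j * (j \in sigma i (r + k%:Z))%:R <= _).
  apply: ler_sum => j /and3P[_ jS /andP[rj dj]].
  have -> : \sum_(k < `|(d - r + 1)%R|%N) \sum_(i < hosts I) rounded c j * (j \in sigma i (r + k%:Z))%:R
     = rounded c j * (\sum_(k < `|(d - r + 1)%R|%N) \sum_(i < hosts I) (j \in sigma i (r + k%:Z)%R))%N%:R.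
    rewrite natr_sum mulr_sumr; apply: eq_bigr => k _.
    by rewrite natr_sum mulr_sumr.
  by rewrite ler_wpM2l ?rounded_ge0 // ler_nat; apply: slots_leq Hs jS rj dj.
rewrite exchange_big /=.
apply: le_trans (_ : \sum_(k < `|(d - r + 1)%R|%N) \sum_(i < hosts I) 1 <= _).
  apply: ler_sum => k _; rewrite exchange_big /=; apply: ler_sum => i _.
  have [_ _ Hcap _ _] := Hs.
  apply: le_trans (rounded_load (Hcap i (r + k%:Z))).
  rewrite [X in X <= _](bigID (mem (sigma i (r + k%:Z)))) /= [X in _ + X]big1 ?addr0; last first.
    by move=> j /andP[_ /negPf ->]; rewrite mulr0.
  rewrite [X in X <= _]big_mkcond [X in _ <= X]big_mkcond; apply: ler_sum => j _.
  case: (boolP (ok j)) => [/and3P[-> _ _]|_] /=; last by case: ifP => // _; apply: rounded_ge0.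
  by case: ifP => [->|]; rewrite ?mulr1 ?andbF.
have -> : d - r + 1 = `|(d - r + 1)%R|%N%:Z by lia.
by rewrite absz_nat !sumr_const !card_ord -mulrnA -PoszM -pmulrn.
Qed.

End Area.

(** * From states to schedules *)

Lemma count_le1_inj (T : eqType) (a : pred T) s u v : (count a s <= 1)%N ->
  u \in s -> v \in s -> a u -> a v -> u = v.
Proof.
rewrite -size_filter => sz us vs au av.
have : u \in filter a s by rewrite mem_filter au.
have : v \in filter a s by rewrite mem_filter av.
by case: (filter a s) sz => [|w [|]] // _; rewrite !inE => /eqP-> /eqP->.
Qed.

Lemma chain_covers lo s hi t : chain lo s hi -> lo <= t < hi ->
  exists2 g, g \in s & ga g <= t <= gb g.
Proof.
elim: s lo => [|g s IH] lo /=; first by move=> /eqP; lia.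
move=> /and3P[/eqP gE lo_gb Hc] Ht; case: (lerP t (gb g)) => tg.
  by exists g; rewrite ?mem_head // gE; lia.
have [|g' gs Hg] := IH _ Hc; first by lia.
by exists g' => //; rewrite inE gs orbT.
Qed.

Definition slots (u : piece) : seq int :=
  [seq ka u + k%:Z | k <- iota 0 `|(kb u - ka u + 1)%R|%N].

Lemma mem_slots u t : ka u <= kb u -> (t \in slots u) = covers u t.
Proof.
move=> ab; apply/mapP/idP => [[k + ->]|]; rewrite /covers.
  by rewrite mem_iota; lia.
by move=> /andP[t1 t2]; exists `|(t - ka u)%R|%N; rewrite ?mem_iota; lia.
Qed.

Lemma count_slots u t : ka u <= kb u -> count_mem t (slots u) = covers u t.
Proof.
move=> ab; rewrite count_uniq_mem ?mem_slots // map_inj_uniq ?iota_uniq //.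
by move=> k l /addrI [].
Qed.

Section Schedule.

Variables (I : instance) (c : bool) (st : state).
Let n := njobs I.
Let Q := scale (jobs I).
Notation job := (@job_at I).
Notation its := (items c Q 0 (jobs I)).

Hypothesis wf : wf_instance I.
Hypothesis Hst : state_spec (hosts I)%:Z Q c its st.

Definition to_job (z : int) : option 'I_n := insub `|z|%N.

(** Partial, since a piece stores plain integers. By [state_spec] the indices are in range on all
    pieces of [st], so [pmap] drops nothing and the encodings agree. *)
Definition to_block (u : piece) : option (block I) :=
  if to_job (kj u) is Some j then
    if insub `|kh u|%N is Some h then Some (Block j h (ka u) (kb u)) else None
  else None.

Definition out_jobs : seq 'I_n := pmap to_job (chosen st).
Definition out_blocks : seq (block I) := pmap to_block (pieces st).

Lemma to_jobK (j : 'I_n) : to_job (val j)%:Z = Some j.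
Proof. exact: valK. Qed.

Lemma chosen_job z : z \in chosen st -> exists2 j : 'I_n, narrow (job j) == c & z = (val j)%:Z.
Proof.
by move=> /(spec_chosen Hst)/mapP[x /itemsP[j jc ->] ->]; exists j.
Qed.

Lemma mem_out_jobs (j : 'I_n) : (j \in out_jobs) = ((val j)%:Z \in chosen st).
Proof.
rewrite mem_pmap; apply/mapP/idP => [[z zc]|jc]; last by exists (val j)%:Z; rewrite ?to_jobK.
by have [k _ zE] := chosen_job zc; rewrite zE to_jobK => -[->]; rewrite -zE.
Qed.

Lemma pieces_spec u : u \in pieces st -> exists (j : 'I_n) (h : 'I_(hosts I)),
  [/\ to_block u = Some (Block j h (ka u) (kb u)), kj u = (val j)%:Z /\ kh u = (val h)%:Z,
      j \in out_jobs, kc u = xs (item_at c j) &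
      release (job j) <= ka u /\ ka u <= kb u <= deadline (job j)].
Proof.
move=> /(spec_pieces Hst)[uc [x [/itemsP[j jc ->] E1 E2 E3 E4]]].
have h0 : (`|kh u| < hosts I)%N by lia.
exists j, (Ordinal h0); split=> //; last by rewrite mem_out_jobs -[(val j)%:Z]E1.
  by rewrite /to_block E1 to_jobK insubT.
by split; rewrite //=; lia.
Qed.

Lemma enc_out : enc_solution out_jobs out_blocks = enc_answer st.
Proof.
rewrite /enc_solution /enc_answer /out_jobs /out_blocks; congr VPair.
  have : {subset chosen st <= chosen st} by [].
  elim: {1 3 4}(chosen st) => //= z s IH Hs.
  have [j _ zE] := chosen_job (Hs z (mem_head _ _)).
  rewrite {1}zE to_jobK /= IH ?zE // => y ys; apply: Hs; rewrite inE ys orbT //.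
have : {subset pieces st <= pieces st} by [].
elim: {1 3 4}(pieces st) => //= u s IH Hs.
have [j [h [-> [E1 E2] _ _ _]]] := pieces_spec (Hs u (mem_head _ _)).
rewrite /= IH; last by move=> y ys; apply: Hs; rewrite inE ys orbT.
by rewrite /enc_block /enc_piece /enc_nat /= E1 E2.
Qed.

Lemma scheduleP i t j : reflect
  (exists2 u, u \in pieces st & [/\ kj u = (val j)%:Z, kh u = (val i)%:Z & covers u t])
  (j \in schedule_of_blocks out_blocks i t).
Proof.
rewrite inE /out_blocks.
have -> p : has p (pmap to_block (pieces st)) = has (fun u => oapp p false (to_block u)) (pieces st).
  by elim: (pieces st) => //= u s IH; case: (to_block u) => [b|] /=; rewrite -IH.
apply: (iffP hasP) => [[u us]|[u us [E1 E2 cov]]];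
  have [j' [h [E [E1' E2'] _ _ _]]] := pieces_spec us.
  by rewrite E => /and3P[/eqP<- /eqP<- cov]; exists u.
exists u => //; rewrite E; apply/and3P; split=> //; apply/eqP; apply: val_inj.
  by move: E1; rewrite E1' => -[].
by move: E2; rewrite E2' => -[].
Qed.

Lemma load_le (t : int) (h : int) : - Q <= t <= Q -> load (pieces st) h t <= Q.
Proof.
move=> Ht; have [|g gs Hg] := chain_covers (spec_chain Hst) (t := t); first by lia.
by have [H _ _] := spec_load Hst gs Hg.
Qed.

Let Q_gt0 : 0 < Q. Proof. exact: scale_gt0. Qed.

Lemma window_scale (j : 'I_n) t : t \in window (job j) -> - Q <= t <= Q.
Proof.
by have := release_scale j; have := deadline_scale j; rewrite /window inE -/Q; lia.
Qed.

Lemma schedule_capacity i t :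
  \sum_(j in schedule_of_blocks out_blocks i t) demand (job j) <= 1.
Proof.
have Q0 : 0 < Q%:~R :> rat by rewrite ltr0z.
(* The segments say nothing about slots outside of [- Q] to [Q]; a slot with a running job lies in a
   window and hence between these bounds. *)
have [E|[j0 j0s]] := set_0Vmem (schedule_of_blocks out_blocks i t).
  by rewrite E big_set0.
have tQ : - Q <= t <= Q.
  have [u us [E1 E2 cov]] := scheduleP _ _ _ j0s.
  have [j [h [_ _ _ _ [r1 d1]]]] := pieces_spec us.
  apply: (@window_scale j); move: cov; rewrite /covers /window inE; lia.
rewrite -(ler_pM2r Q0) mul1r mulr_suml.
have := load_le (val i)%:Z tQ; rewrite -(ler_int rat); apply: le_trans.
rewrite /load raddf_sum /=.
(* Each running job is charged to a piece of its own that covers the slot on this host. *)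
apply: le_trans (_ : \sum_(j : 'I_n) \sum_(u <- pieces st | ((kh u == (val i)%:Z) && covers u t)
    && (kj u == (val j)%:Z)) (kc u)%:~R <= _).
  rewrite [X in X <= _]big_mkcond /=; apply: ler_sum => j _.
  case: ifP => [/scheduleP[u us [E1 E2 cov]]|_]; last first.
    rewrite big_seq_cond sumr_ge0 // => u /andP[us _].
    have [j' [h [_ _ _ -> _]]] := pieces_spec us; rewrite xs_item_at.
    by apply: mulr_ge0; [exact: rounded_ge0|exact: ltW].
  rewrite (big_rem u us) /= E1 E2 cov !eqxx /= ler_wpDr //.
    rewrite big_seq_cond sumr_ge0 // => v /andP[/mem_rem vs _].
    have [j' [h [_ _ _ -> _]]] := pieces_spec vs; rewrite xs_item_at.
    by apply: mulr_ge0; [exact: rounded_ge0|exact: ltW].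
  have [j' [h [_ [E1' _] _ -> _]]] := pieces_spec us; rewrite xs_item_at.
  have -> : j' = j by apply: val_inj; move: E1; rewrite E1' => -[].
  rewrite ler_pM2r // /rounded; case: c => //.
  by have [_ _ /andP[]] := wf.2 j.
rewrite (exchange_big_dep (fun u => (kh u == (val i)%:Z) && covers u t)) /=; last first.
  by move=> j u _ /andP[].
rewrite big_seq_cond [X in _ <= X]big_seq_cond; apply: ler_sum => u /andP[us cov].
have [j [h [_ [E1 _] _ _ _]]] := pieces_spec us.
by rewrite (big_pred1 j) // => k; rewrite /= cov /= E1 eqz_nat eq_sym.
Qed.

Lemma schedule_ok : is_schedule_of [set j in out_jobs] (schedule_of_blocks out_blocks).
Proof.
split.
- move=> i t; apply/subsetP => j /scheduleP[u us [E1 _ _]].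
  have [j' [h [_ [E1' _] jo _ _]]] := pieces_spec us.
  by rewrite inE; have -> : j = j' by apply: val_inj; move: E1; rewrite E1' => -[].
- move=> i t j /scheduleP[u us [E1 _ cov]].
  have [j' [h [_ [E1' _] _ _ [H1 H2]]]] := pieces_spec us.
  have -> : j = j' by apply: val_inj; move: E1; rewrite E1' => -[].
  by move: cov; rewrite /covers /window inE; lia.
- exact: schedule_capacity.
- move=> i i' t j /scheduleP[u us [E1 E2 cov]] /scheduleP[v vs [E1' E2' cov']].
  have uv : u = v.
    apply: (count_le1_inj (spec_once Hst (val j)%:Z t) us vs).
      by rewrite /runs_at E1 eqxx.
    by rewrite /runs_at E1' eqxx.
  by apply: val_inj; move: E2; rewrite uv E2' => -[].
move=> j; rewrite inE mem_out_jobs => jc.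
have ab u : u \in pieces st -> ka u <= kb u.
  by move=> /pieces_spec[j' [h [_ _ _ _ [_ /andP[]]]]].
pose us := [seq u <- pieces st | kj u == (val j)%:Z].
have ab' u : u \in us -> ka u <= kb u by rewrite mem_filter => /andP[_ /ab].
(* The slots of all pieces of [j]: distinct by [spec_once], and of the right number by
   [spec_work]. *)
exists (flatten [seq slots u | u <- us]).
have countE t : count_mem t (flatten [seq slots u | u <- us]) = count (covers^~ t) us.
  elim: us ab' => //= u s IH abu; rewrite count_cat count_slots ?IH //.
    by move=> v vs; apply: abu; rewrite inE vs orbT.
  by apply: abu; rewrite mem_head.
split.
- apply: count_mem_uniq => t; apply/eqP.
  have le1 : (count_mem t (flatten [seq slots u | u <- us]) <= 1)%N.
    rewrite countE /us count_filter; apply: leq_trans (spec_once Hst (val j)%:Z t).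
    by apply: sub_count => u /andP[? ?]; apply/andP.
  have := has_pred1 t (flatten [seq slots u | u <- us]); rewrite has_count.
  by move: le1; case: (t \in _); case: (count _ _) => [|[|]].
- have [j' jn jE] := chosen_job jc.
  have jj : j = j' by apply: val_inj; move: jE => -[].
  have := spec_work Hst (mem_items jn); rewrite -jj => /(_ jc) /= W.
  have sizeE : (size (flatten [seq slots u | u <- us]))%:Z = \sum_(u <- us) piece_len u.
    elim: us ab' {countE} => [_|u us' IH abu] /=; first by rewrite big_nil.
    rewrite big_cons size_cat PoszD IH => [|v vs]; last by apply: abu; rewrite inE vs orbT.
    have := abu u (mem_head _ _).
    rewrite /piece_len /slots size_map size_iota; move: (\sum_(_ <- _) _) => W' H.
    by have -> : `|(kb u - ka u + 1)%R|%N%:Z = kb u - ka u + 1 by lia.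
  by rewrite -lez_nat sizeE /us big_filter -/(work _ _) W.
move=> t /flattenP[_ /mapP[u + ->]]; rewrite mem_filter => /andP[/eqP E1 us'].
rewrite mem_slots ?ab // => cov.
have [j' [h [_ [E1' E2'] _ _ [H1 H2]]]] := pieces_spec us'.
have jj : j = j' by apply: val_inj; move: E1; rewrite E1' => -[].
split; last by exists h; apply/scheduleP; exists u.
by rewrite jj; move: cov; rewrite /covers /window inE; lia.
Qed.

End Schedule.

(** * Approximation ratio, in each class and for the better solution *)

Section Ratio.

Variables (I : instance) (c : bool) (K : int).
Let Q := scale (jobs I).
Notation job := (@job_at I).
Notation its := (items c Q 0 (jobs I)).

Hypotheses (wf : wf_instance I) (lam_inst : laminar I) (K_ge0 : 0 <= K).
Hypothesis K_slack : forall j : 'I_(njobs I),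
  let x := item_at c j in xlen x + xlen x <= K * (xlen x - xp x).

Definition run : state := solve (hosts I)%:Z Q K its.

Let hosts_gt0 : 0 < (hosts I)%:Z. Proof. by rewrite ltz_nat; case: wf. Qed.

Lemma run_spec : state_spec (hosts I)%:Z Q c its run.
Proof.
by have [] := solve_spec hosts_gt0 (scale_gt0 I) K_ge0 erefl (items_uniq I c)
  (items_good wf K_slack) (items_nested wf K_slack lam_inst).
Qed.

Lemma residual_items P :
  residual P its = \sum_(j | (narrow (job j) == c) && P (xi (item_at c j))) xw (item_at c j).
Proof. exact: big_items. Qed.

Lemma gain_run : (gain run)%:~R = total_profit [set j in out_jobs I run] * Q%:~R.
Proof.
rewrite (spec_gain run_spec) big_items raddf_sum /= /total_profit mulr_suml.
rewrite (eq_bigl (fun j => j \in [set j in out_jobs I run])) => [|j].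
  by apply: eq_bigr => j _; rewrite xw_item_at.
rewrite inE (mem_out_jobs run_spec).
apply: andb_idl => jc; have [k kc jk] := chosen_job run_spec jc.
by have <- : k = j by apply: val_inj; move: jk => -[].
Qed.

Lemma run_ratio (S : {set 'I_(njobs I)}) : feasible S ->
  \sum_(j in S | narrow (job j) == c) profit (job j) * Q%:~R <=
  (1 + K)%:~R * (gain run)%:~R.
Proof.
move=> HS; have [_ ratio] := solve_spec hosts_gt0 (scale_gt0 I) K_ge0 erefl (items_uniq I c)
  (items_good wf K_slack) (items_nested wf K_slack lam_inst).
pose P z := [exists j in S, (val j)%:Z == z].
have := ratio P (fun r d rd => feasible_area c wf HS rd).
rewrite -/Q -/(solve (hosts I)%:Z Q K its) -/run.
(* Initially the residual profits are the scaled profits. *)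
have -> : residual (fun j => j \in chosen run) its = gain run.
  by rewrite (spec_gain run_spec) residual_items big_items.
rewrite residual_items -(ler_int rat) raddf_sum intrM /=; apply: le_trans.
rewrite le_eqVlt; apply/orP; left; apply/eqP; apply: eq_big => [j|j _]; last by rewrite xw_item_at.
rewrite andbC; congr andb; apply/idP/exists_inP => [jS|[k kS /eqP[/val_inj <-]]] //.
by exists j.
Qed.

End Ratio.

(** The gains of the two classes are scaled by the same [Q] and hence comparable. Up to the factor
    [1 + K] the larger one bounds both the narrow and the wide part of a feasible set; adding the
    parts gives the factor 2. *)
Lemma answer_approx (I : instance) (K : int) : wf_instance I -> laminar I -> 0 <= K ->
  (forall c (j : 'I_(njobs I)),
     let x := item_at c j in xlen x + xlen x <= K * (xlen x - xp x)) ->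
  exists (s : seq 'I_(njobs I)) (B : seq (block I)),
    let S := [set j in s] in
    [/\ enc_answer (answer K I) = enc_solution s B,
        is_schedule_of S (schedule_of_blocks B)
      & forall S' : {set 'I_(njobs I)}, feasible S' ->
          (2 * (1 + K)%:~R)^-1 * total_profit S' <= total_profit S].
Proof.
move=> wf lam K0 slk; have [b ansE bestE] : exists2 b,
    answer K I = run I b K & forall c, gain (run I c K) <= gain (run I b K).
  rewrite /answer /best -/(run I true K) -/(run I false K).
  case: lerP => H; [exists true|exists false] => // -[] //; exact: ltW.
have Hb := run_spec wf lam K0 (slk b).
exists (out_jobs I (run I b K)), (out_blocks I (run I b K)) => S; split.
- by rewrite ansE (enc_out Hb).
- exact: schedule_ok wf Hb.
move=> S' HS'; have Q0 : 0 < (scale (jobs I))%:~R :> rat by rewrite ltr0z scale_gt0.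
have K1 : 0 < (1 + K)%:~R :> rat by rewrite ltr0z; lia.
rewrite ler_pdivrMl ?mulr_gt0 // -(ler_pM2r Q0) -!mulrA -(gain_run wf lam K0 (slk b)).
have ratio c : \sum_(j in S' | narrow (job_at j) == c) profit (job_at j) * (scale (jobs I))%:~R <=
    (1 + K)%:~R * (gain (run I b K))%:~R.
  by apply: le_trans (run_ratio wf lam K0 (slk c) HS') _; rewrite ler_pM2l // ler_int.
rewrite /total_profit mulr_suml (bigID (fun j => narrow (job_at j) == true)) /=.
have := ratio true; have := ratio false.
rewrite (eq_bigl (fun j => (j \in S') && ~~ (narrow (job_at j) == true))) => [|j]; last by case: narrow.
by move: (\sum_(_ in _ | _) _) (\sum_(_ in _ | _) _) (_ * (gain _)%:~R) => x y z; lra.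
Qed.

Lemma trunc_log_exp2z k : trunc_log 2 `|(2 ^+ k : int)|%N = k.
Proof. by rewrite exp2z absz_nat trunc_expnK. Qed.

(** * Polynomial running time *)

Section Time.

Variables (I : instance) (K : nat).
Hypothesis wf : wf_instance I.
Hypothesis K_slack : forall c (j : 'I_(njobs I)),
  let x := item_at c j in xlen x + xlen x <= K%:Z * (xlen x - xp x).

Let N := vsize (enc_instance I).
Let n := njobs I.
Let Q := scale (jobs I).
Let e : int := 2 ^+ N.
(** [6 * N] bits for the initial profits, and [K + 9 * N] for each of fewer than [N + 1] local-ratio
    steps. *)
Let M : int := 2 ^+ (6 * N + (K + 9 * N) * (N + 1)).
(** Room for [(K + 1) * e ^+ 8]: here [K + 1 <= 2 ^ K], and [e ^+ 8] bounds both the area of a job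
    and [m * Q * xlen y]. *)
Let G : int := 2 ^+ (K + 9 * N).
Let L := ((N + 2) * (3 * N + 5))%N.

Let n_leq : (n + 4 <= N)%N.
Proof.
have := size_vsize_seq enc_job (jobs I); rewrite size_tuple -/n.
by rewrite /N /enc_instance /enc_nat /=; move: (trunc_log _ _) (vsize (enc_seq _ _)) => a b; lia.
Qed.

Let jobs_size : (vsize (enc_seq enc_job (jobs I)) <= N)%N.
Proof. by rewrite /N /= -addSn leq_addl. Qed.

Let exp_le k l : (k <= l)%N -> 2 ^+ k <= 2 ^+ l :> int.
Proof. by move=> kl; rewrite ler_weXn2l. Qed.

Let e_ge4 : 4 <= e.
Proof. by have := @exp_le 2 N ltac:(lia); rewrite expr2 /e; lia. Qed.

Let expE k : e ^+ k = 2 ^+ (k * N).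
Proof. by rewrite /e mulnC exprM. Qed.

Let expM k : (k <= 15)%N -> e ^+ k <= M.
Proof. by move=> k15; rewrite expE; apply: exp_le; nia. Qed.

Let Q_le : 1 <= Q <= e ^+ 5.
Proof.
have /andP[-> H] := scale_bound (jobs I); rewrite expE; apply: le_trans H _.
by apply: exp_le; rewrite leq_mul2l jobs_size.
Qed.

Let ints_inst : ints e (enc_instance I). Proof. exact: ints_vsize. Qed.

Let ints_job (j : 'I_n) : ints e (enc_job (job_at j)).
Proof.
have : ints e (enc_seq enc_job (jobs I)) by case/andP: ints_inst.
rewrite ints_seq; last by lia.
by move=> /(all_nthP (job_at j))/(_ j); rewrite size_tuple -tnth_nth; apply.
Qed.

Lemma xw_bound c (j : 'I_n) : 0 <= xw (item_at c j) <= e ^+ 6.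
Proof.
have [_ _ _ w0] := wf.2 j; have Q1 := Q_le.
have num0 : 0 <= numq (profit (job_at j)) by rewrite numq_ge0.
have nume : numq (profit (job_at j)) <= e by have := ints_job j; rewrite /=; move: num0; clear; lia.
have den0 := denq_gt0 (profit (job_at j)).
have : xw (item_at c j) * denq (profit (job_at j)) = numq (profit (job_at j)) * Q.
  rewrite /= divzK //; apply: dvdz_mull; apply: dvdz_trans (dvd_scale_factor j).
  by rewrite /scale_factor dvdz_mulr // dvdz_mull.
move: (xw _) (denq _) den0 (numq _) num0 nume => w d d0 k k0 ke E.
have kQ : 0 <= k * Q <= e * e ^+ 5.
  by apply/andP; split; [apply: mulr_ge0; lia|apply: ler_pM; lia].
by rewrite exprS; move: (e * _) (k * Q) kQ E => a b H E; clear -d0 H E; nia.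
Qed.

Let items_growth c : {in items c Q 0 (jobs I), forall x, growth_ok M x} /\
  {in items c Q 0 (jobs I) & items c Q 0 (jobs I), forall x y,
    K%:Z * (xs x * xp x) + `|(hosts I)%:Z * Q * xlen y| <= G}.
Proof.
have eM : e <= M by have := @expM 1 isT; rewrite expr1.
have basic x : x \in items c Q 0 (jobs I) -> [/\ `|xi x| <= e, `|xr x| <= e, `|xd x| <= e,
    0 <= xp x <= e & 0 <= xs x <= e ^+ 5].
  move=> xits; have [[s0 sQ _] _ _ _ _] := items_good wf (K_slack c) xits.
  move: s0 sQ; have [j jc ->] := itemsP xits => s0 sQ.
  have := ints_job j; rewrite [ints _ _]/= => Hj; split; try by move: Hj; clear; rewrite /=; lia.
  - have : n%:Z <= e by rewrite /e exp2z lez_nat; apply: leq_trans (ltnW (ltn_expl N _)) => //; lia.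
    by have := ltn_ord j; rewrite /= -/n; move: (nat_of_ord j) => k; lia.
  - by apply/andP; split; [exact: ltW|apply: le_trans sQ _; case/andP: Q_le].
split=> [x xits|x y xits yits].
  have [H1 H2 H3 H4 H5] := basic x xits.
  have : 0 <= xw x <= e ^+ 6 by have [j _ ->] := itemsP xits; apply: xw_bound.
  have := @expM 5 isT; have := @expM 6 isT; rewrite /growth_ok.
  by clear -eM H1 H2 H3 H4 H5; lia.
have [_ _ _ /andP[p0 pe] /andP[s0 se]] := basic x xits; have [_ r1 d1 _ _] := basic y yits.
have A : xs x * xp x <= e ^+ 8.
  apply: le_trans (_ : e ^+ 5 * e <= _); first by apply: ler_pM.
  by rewrite -exprSr; apply: ler_weXn2l => //; lia.
have B : `|(hosts I)%:Z * Q * xlen y| <= e ^+ 8.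
  rewrite !normrM; have -> : e ^+ 8 = e * e ^+ 5 * e ^+ 2 by ring.
  apply: ler_pM => //.
    apply: ler_pM => //; last by move: Q_le; lia.
    by move: ints_inst => /= /andP[].
  by rewrite /xlen expr2; clear -r1 d1 e_ge4; nia.
apply: le_trans (_ : (2 ^ K)%N%:Z * e ^+ 8 <= _).
  apply: le_trans (_ : (K%:Z + 1) * e ^+ 8 <= _).
    by rewrite mulrDl mul1r lerD // ler_wpM2l.
  rewrite ler_wpM2r //; first by rewrite exprn_ge0; lia.
  by have := ltn_expl K (isT : (1 < 2)%N); lia.
by rewrite -exp2z expE -exprD; apply: exp_le; lia.
Qed.

Let gains_bound s F : 0 <= F -> {in s, forall x, `|xw x| <= F} -> gains s <= (size s)%:Z * F.
Proof.
move=> F0; elim: s => [|x s IH] H; first by rewrite /gains big_nil mul0r.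
rewrite gains_cons /= -add1n PoszD mulrDl mul1r lerD //; first by apply: H; rewrite mem_head.
by apply: IH => y ys; apply: H; rewrite inE ys orbT.
Qed.

Lemma call_main : callb (prog K) (size_bound M L) 0 (enc_instance I)
  (enc_answer (answer K I)) (2 * ((n + 1) * (4 * L + 6)) + 2 * ((n + 1) * (n + 1)) + n + 2).
Proof.
have eM : e <= M by have := @expM 1 isT; rewrite expr1.
have ne : n%:Z <= e.
  by rewrite /e exp2z lez_nat; apply: leq_trans (ltnW (ltn_expl N _)) => //; lia.
have /andP[mE jE] := ints_inst.
apply: run_main => //; rewrite -/n -/Q; try lia.
- exact: ints_leq jE.
- move=> i; have /andP[H1 H2] := scale_bound (drop i (jobs I)).
  rewrite (le_trans _ H1) //; apply: le_trans H2 (le_trans _ (@expM 5 isT)).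
  rewrite expE; apply: exp_le; rewrite leq_mul2l; apply/orP; right.
  exact: leq_trans (vsize_seq_drop _ _ _) jobs_size.
- by rewrite /L leq_mul //; lia.
move=> c s; have [Hg Hp] := items_growth c.
have sz : (size s <= n)%N by apply: leq_trans (size_items _ _ _ _) _; rewrite size_tuple.
have e6 : 0 <= e ^+ 6 by rewrite exprn_ge0; lia.
have Hw : {in s, forall x, `|xw x| <= e ^+ 6 /\ xf x = xw x}.
  move=> x /itemsP[j _ ->]; split=> //; have /andP[w0 we] := xw_bound c j.
  by rewrite ger0_norm.
have T : traced K M (hosts I)%:Z Q (size s) s.
  apply: (@growth_traced _ _ _ _ G _ _ _ _ _ (e ^+ 6)) => //; try lia.
  - have := ltn_expl K (isT : (1 < 2)%N); have := @exp_le K (K + 9 * N) ltac:(lia).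
    by rewrite -/G exp2z; lia.
  - by move=> x /Hw[? ->].
  - rewrite expE -exprM -exprD; apply: exp_le; rewrite leq_add2l leq_mul2l.
    by rewrite addn1 ltnW ?orbT // ltnS; lia.
  - by apply: exp_le; rewrite -[X in (X <= _)%N]add0n leq_add // -[X in (X <= _)%N]muln1 leq_mul2l addn1 orbT.
split=> //; first exact: traced_ok T.
- apply/allP => x /itemsP[j _ ->] /=; have := ints_job j; rewrite /= => Hj.
  have := @expM 2 isT; rewrite expr2 => ee.
  have ee' : e + 1 <= e * e by clear -e_ge4; nia.
  by move: Hj ee ee'; clear; lia.
- apply: le_trans (gains_bound e6 _) _; first by move=> x /Hw[].
  apply: le_trans (@expM 7 isT); rewrite exprS ler_wpM2r //.
  by apply: le_trans ne; rewrite lez_nat.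
Qed.

(** There are of the order of [N ^ 3] calls, each budgeted in proportion to the maximal size of a
    value, that is of the order of [N ^ 2] leaves times [N ^ 2] bits. *)
Lemma polytime_main : exists y t, runs (prog K) (enc_instance I) y t /\
  (t <= (1 + 419 * (table_cost (prog K)).+1 * (444 * (2 * K + 27))) * N ^ 7)%N.
Proof.
have [_ _ [body [t [Ef Eb Ht]]]] := call_main.
exists (enc_answer (answer K I)), (N + t + vsize (enc_answer (answer K I)))%N; split.
  by apply: EvalCall Ef _ Eb; constructor.
set C := (table_cost _).+1 in Ht *.
have HL : (L <= 24 * N ^ 2)%N by rewrite /L; clear -n_leq; nia.
have HB : (size_bound M L <= 444 * (2 * K + 27) * N ^ 4)%N.
  rewrite /size_bound /M trunc_log_exp2z.
  have -> : (444 * (2 * K + 27) * N ^ 4 = 444 * N ^ 2 * ((2 * K + 27) * N ^ 2))%N by ring.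
  apply: leq_mul; first by clear -HL n_leq; nia.
  by clear -n_leq; nia.
have Hc : (2 * ((n + 1) * (4 * L + 6)) + 2 * ((n + 1) * (n + 1)) + n + 2 <= 419 * N ^ 3)%N.
  have -> : (419 * N ^ 3 = 2 * (2 * N * (102 * N ^ 2)) + 8 * N ^ 2 * N + 3 * N ^ 3)%N by ring.
  have H1 : ((n + 1) * (4 * L + 6) <= 2 * N * (102 * N ^ 2))%N.
    by apply: leq_mul; [lia|clear -HL n_leq; nia].
  have H2 : (2 * ((n + 1) * (n + 1)) <= 8 * N ^ 2 * N)%N.
    by clear -n_leq; nia.
  have H3 : (n + 2 <= 3 * N ^ 3)%N by clear -n_leq; nia.
  by rewrite -addnA leq_add // leq_add // leq_mul2l H1 orbT.
rewrite -addnA mulnDl mul1n leq_add //; first by rewrite -[X in (X <= _)%N]expn1 leq_exp2l; lia.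
apply: leq_trans Ht _.
have -> : (419 * C * (444 * (2 * K + 27)) * N ^ 7 =
  419 * N ^ 3 * (C * (444 * (2 * K + 27) * N ^ 4)))%N by ring.
by rewrite leq_mul // leq_mul.
Qed.

End Time.

Lemma slack_items (R : realType) (lam : R) (I : instance) (K : nat) :
  wf_instance I -> slack lam I -> lam < 1 -> 2 / (1 - lam) <= K%:R ->
  forall c (j : 'I_(njobs I)),
    let x := item_at c j in xlen x + xlen x <= K%:Z * (xlen x - xp x).
Proof.
move=> wf slk lam1 HK c j; rewrite ler_pdivrMr ?subr_gt0 // in HK.
pose x := item_at c j; suff: xlen x + xlen x <= K%:Z * (xlen x - xp x) by [].
have [rd _ _ _] := wf.2 j; have l0 : 0 <= (xlen x)%:~R :> R by rewrite ler0z /xlen /=; lia.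
have Hp : (xp x)%:~R <= lam * (xlen x)%:~R := slk j.
rewrite -(ler_int R) intrM intrB intrD -[K%:Z%:~R]/(K%:R).
move: (xlen x)%:~R (xp x)%:~R l0 Hp => l p l0 Hp.
have := ler_wpM2l l0 HK; have : K%:R * (l - lam * l) <= K%:R * (l - p).
  by rewrite ler_wpM2l // lerD2l lerN2.
by move: K%:R {HK} => k; lra.
Qed.

Theorem theorem4 (R : realType) (lam : R) (lam_gt0 : 0 < lam) (lam_lt1 : lam < 1) :
  exists2 c : rat, 0 < c &
    exists p : program,
      let P := fun I : instance =>
        [/\ wf_instance I, laminar I & slack lam I] in
      polytime_on p P /\ approximates p c P.
Proof.
(* The only trace of the real number [lam] in the program is this integer constant, provided by the
   archimedean property. *)
pose K := Num.bound (2 / (1 - lam)).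
have K_ge : 2 / (1 - lam) <= K%:R.
  by apply: ltW; apply: archi_boundP; rewrite divr_ge0 // subr_ge0 ltW.
exists (2 * (1 + K%:Z)%:~R)^-1.
  by rewrite invr_gt0 mulr_gt0 // ltr0z.
exists (prog K) => P; split.
  exists (1 + 419 * (table_cost (prog K)).+1 * (444 * (2 * K + 27)))%N, 7 => I [wf _ slk].
  exact: polytime_main wf (slack_items wf slk lam_lt1 K_ge).
move=> I [wf lami slk] y t /= Hrun.
have HK := slack_items wf slk lam_lt1 K_ge.
have [_ _ [body [t' [Ef Eb _]]]] := call_main wf HK.
have Harg := @EvalVar (prog K) [:: enc_instance I] 0 _ erefl.
(* [approximates] speaks of an arbitrary run; determinism identifies it with the one constructed. *)
have [-> _] := eval_det Hrun (EvalCall Ef Harg Eb).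
exact: answer_approx.
Qed.
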